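(* Let $f$ be meromorphic on $\mathbb{C}$ with divisor $D=((a_n),(b_n))$. Suppose that for every $\delta>0$ there is $C_\delta$ with $1/C_\delta\le|f(z)|\le C_\delta$ for all $z\notin A(\delta)$, that $\inf_{n,k}|a_n-b_k|>0$, and that there is $C_0$ with ${\rm card}\{n:|a_n-c|\le1\}+{\rm card}\{n:|b_n-c|\le1\}<C_0$ for all $c\in\mathbb{C}$. Then $f$ is a normal function.
   Context: $\rho_S$ is the spherical metric. A meromorphic $f$ on $\mathbb{C}$ is normal if every sequence $(h_n)\subset\mathbb{C}$ has a subsequence $(h_{n'})$ with $\rho_S(f(z+h_{n'}),f(z+h_{m'}))\to0$ as $n',m'\to\infty$ uniformly on compact subsets of $\mathbb{C}$. The divisor lists zeros $a_n$ and poles $b_n$ with multiplicity. $A(\delta)=\bigcup_nB(a_n,\delta)\cup\bigcup_nB(b_n,\delta)$. *)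

(* Defs.v *)
From Stdlib Require Import Reals List.
Open Scope R_scope.

Definition Cplx : Type := (R * R)%type.
Definition Cadd (z w : Cplx) : Cplx := (fst z + fst w, snd z + snd w).
Definition Copp (z : Cplx) : Cplx := (- fst z, - snd z).
Definition Csub (z w : Cplx) : Cplx := Cadd z (Copp w).
Definition Cmul (z w : Cplx) : Cplx :=
  (fst z * fst w - snd z * snd w, fst z * snd w + snd z * fst w).
Definition C0 : Cplx := (0, 0).
Definition C1 : Cplx := (1, 0).
Fixpoint Cpow (z : Cplx) (n : nat) : Cplx :=
  match n with O => C1 | S k => Cmul z (Cpow z k) end.
Definition Cnorm (z : Cplx) : R := sqrt (fst z * fst z + snd z * snd z).

Definition Cdiff_at (g : Cplx -> Cplx) (z : Cplx) : Prop :=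
  exists l : Cplx, forall eps, 0 < eps -> exists d, 0 < d /\
    forall w, 0 < Cnorm (Csub w z) < d ->
      Cnorm (Csub (Csub (g w) (g z)) (Cmul l (Csub w z))) <= eps * Cnorm (Csub w z).

Definition holo_disc (g : Cplx -> Cplx) (z0 : Cplx) (r : R) : Prop :=
  forall z, Cnorm (Csub z z0) < r -> Cdiff_at g z.

(* ---------- meromorphic functions Cplx -> Cplx ∪ {∞} (None = ∞) ---------- *)
Definition meromorphic (f : Cplx -> option Cplx) : Prop :=
  forall z0, exists r, 0 < r /\
    ((exists g, holo_disc g z0 r /\ forall w, Cnorm (Csub w z0) < r -> f w = Some (g w))
     \/
     (f z0 = None /\ exists h, holo_disc h z0 r /\ h z0 = C0 /\
        forall w, 0 < Cnorm (Csub w z0) < r ->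
          h w <> C0 /\ exists v, f w = Some v /\ Cmul (h w) v = C1)).

Definition zero_mult (f : Cplx -> option Cplx) (z : Cplx) (m : nat) : Prop :=
  (m = 0%nat /\ f z <> Some C0) \/
  ((0 < m)%nat /\ exists r g, 0 < r /\ holo_disc g z r /\ g z <> C0 /\
     forall w, Cnorm (Csub w z) < r -> f w = Some (Cmul (Cpow (Csub w z) m) (g w))).

Definition pole_mult (f : Cplx -> option Cplx) (z : Cplx) (m : nat) : Prop :=
  (m = 0%nat /\ f z <> None) \/
  ((0 < m)%nat /\ f z = None /\ exists r g, 0 < r /\ holo_disc g z r /\ g z <> C0 /\
     forall w, 0 < Cnorm (Csub w z) < r ->
       exists v, f w = Some v /\ Cmul (Cpow (Csub w z) m) v = g w).

Definition set_card (P : nat -> Prop) (k : nat) : Prop :=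
  exists l : list nat, NoDup l /\ length l = k /\ forall n, In n l <-> P n.

(* Divisor D = ((a_n)_{n in Ia}, (b_n)_{n in Ib}): zeros and poles listed with
   multiplicity (index sets Ia, Ib ⊆ nat allow finite or infinite lists). *)
Definition is_divisor (f : Cplx -> option Cplx)
  (Ia : nat -> Prop) (a : nat -> Cplx) (Ib : nat -> Prop) (b : nat -> Cplx) : Prop :=
  forall z, exists m1 m2,
    zero_mult f z m1 /\ set_card (fun n => Ia n /\ a n = z) m1 /\
    pole_mult f z m2 /\ set_card (fun n => Ib n /\ b n = z) m2.

Definition inA (Ia : nat -> Prop) (a : nat -> Cplx) (Ib : nat -> Prop) (b : nat -> Cplx)
  (delta : R) (z : Cplx) : Prop :=
  (exists n, Ia n /\ Cnorm (Csub z (a n)) < delta) \/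
  (exists n, Ib n /\ Cnorm (Csub z (b n)) < delta).

Definition rhoS (u v : option Cplx) : R :=
  match u, v with
  | Some z, Some w => 2 * Cnorm (Csub z w) /
        (sqrt (1 + Cnorm z * Cnorm z) * sqrt (1 + Cnorm w * Cnorm w))
  | Some z, None | None, Some z => 2 / sqrt (1 + Cnorm z * Cnorm z)
  | None, None => 0
  end.

(* every sequence (h_n) has a subsequence h_{φ n} such that f(z + h_{φ n}) is
   uniformly Cauchy for ρ_S on compact sets (equivalently on closed discs |z| <= R) *)
Definition normal_function (f : Cplx -> option Cplx) : Prop :=
  forall h : nat -> Cplx, exists phi : nat -> nat,
    (forall n, (phi n < phi (S n))%nat) /\
    forall Rad eps, 0 < eps -> exists N, forall n m, (N <= n)%nat -> (N <= m)%nat ->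
      forall z, Cnorm z <= Rad ->
        rhoS (f (Cadd z (h (phi n)))) (f (Cadd z (h (phi m)))) < eps.

(* Main.v *)
Require Import Defs.
From Stdlib Require Import Reals List Lra Lia ClassicalEpsilon.
From Coquelicot Require Import Coquelicot.
Open Scope R_scope.

(** The family [f (z + h)] is equi-Lipschitz for the spherical metric, and
    Arzelà–Ascoli applies. Indeed, a disc of radius [eta / 2] contains no pole or no
    zero of [f], so [g = f] or [g = 1/f] is holomorphic there. Since the number of
    zeros and poles in a unit disc is bounded, every point [z] of the smaller disc is the
    centre of a circle, of radius bounded below, that avoids [A(delta)] for a fixed
    [delta]; there [|g| <= C_delta], and Cauchy's estimate at the centre bounds
    [|g'(z)|] uniformly. Cauchy's estimate is derived from Goursat's bisection
    argument, as only complex differentiability is assumed. *)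

(** * Complex derivatives and the exponential *)

(** In the coordinate [w] with [zeta = z0 + cexp w] such a mean is an integral over a vertical
    segment of height [2 * PI], and an annulus becomes a rectangle. Hence Goursat's theorem for
    rectangles is enough, and the centre, pushed off to infinity, leaves no singularity to remove.
    Only the real form Im(H dw) is ever integrated; unimodular factors turn bounds on real parts
    into bounds on moduli. Distances are measured after stereographic projection into R^3, which
    supplies the triangle inequality, the symmetry between f and 1/f, and a bounded target for the
    compactness argument. The resulting Lipschitz constant is valid on the whole plane, so all
    translates of f share it. *)

Definition Cder (g : C -> C) (z l : C) : Prop :=
  forall eps, 0 < eps -> exists d, 0 < d /\
    forall w : C, Cmod (w - z) < d ->
      Cmod (g w - g z - l * (w - z))%C <= eps * Cmod (w - z).

Lemma Cmod_Re_Im (z : C) : Cmod z <= Rabs (fst z) + Rabs (snd z).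
Proof.
  replace z with (RtoC (fst z) + RtoC (snd z) * Ci)%C at 1.
  - eapply Rle_trans; [apply Cmod_triangle|].
    rewrite Cmod_mult, Cmod_Ci, !Cmod_R; lra.
  - destruct z; unfold RtoC, Ci, Cplus, Cmult; simpl; f_equal; ring.
Qed.

Lemma Re_Cmod (z : C) : Rabs (fst z) <= Cmod z.
Proof. exact (re_le_Cmod z). Qed.

Lemma Im_Cmod (z : C) : Rabs (snd z) <= Cmod z.
Proof. eapply Rle_trans; [apply Rmax_r|apply Rmax_Cmod]. Qed.

Lemma Cder_ext_loc (f g : C -> C) (z l : C) (r : R) :
  0 < r -> (forall w, Cmod (w - z) < r -> f w = g w) -> Cder f z l -> Cder g z l.
Proof.
  intros Hr E H eps He. destruct (H eps He) as [d [Hd Hw]].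
  exists (Rmin d r); split; [now apply Rmin_pos|].
  intros w Hwz. pose proof (Rmin_l d r); pose proof (Rmin_r d r).
  rewrite <- (E w), <- (E z); [apply Hw; lra| |lra].
  replace (z - z)%C with (RtoC 0) by ring. now rewrite Cmod_0.
Qed.

Lemma Cder_lip (g : C -> C) (z l : C) : Cder g z l ->
  exists d, 0 < d /\ forall w : C, Cmod (w - z) < d ->
    Cmod (g w - g z)%C <= (Cmod l + 1) * Cmod (w - z).
Proof.
  intros H. destruct (H 1 Rlt_0_1) as [d [Hd Hw]]. exists d; split; auto.
  intros w Hwz. specialize (Hw w Hwz).
  replace (g w - g z)%C with ((g w - g z - l * (w - z)) + l * (w - z))%C by ring.
  eapply Rle_trans; [apply Cmod_triangle|]. rewrite Cmod_mult. lra.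
Qed.

Lemma Cder_const (c z : C) : Cder (fun _ => c) z 0.
Proof.
  intros eps He. exists 1; split; [lra|]. intros w _.
  replace (c - c - 0 * (w - z))%C with (RtoC 0) by ring. rewrite Cmod_0.
  pose proof (Cmod_ge_0 (w - z)); nra.
Qed.

Lemma Cder_id (z : C) : Cder (fun w => w) z 1.
Proof.
  intros eps He. exists 1; split; [lra|]. intros w _.
  replace (w - z - 1 * (w - z))%C with (RtoC 0) by ring. rewrite Cmod_0.
  pose proof (Cmod_ge_0 (w - z)); nra.
Qed.

Lemma Cder_plus (f g : C -> C) (z l m : C) :
  Cder f z l -> Cder g z m -> Cder (fun w => f w + g w)%C z (l + m)%C.
Proof.
  intros Hf Hg eps He.
  destruct (Hf (eps / 2)) as [d1 [Hd1 H1]]; [lra|].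
  destruct (Hg (eps / 2)) as [d2 [Hd2 H2]]; [lra|].
  exists (Rmin d1 d2); split; [now apply Rmin_pos|]. intros w Hw.
  pose proof (Rmin_l d1 d2); pose proof (Rmin_r d1 d2).
  specialize (H1 w ltac:(lra)); specialize (H2 w ltac:(lra)).
  replace (f w + g w - (f z + g z) - (l + m) * (w - z))%C with
    ((f w - f z - l * (w - z)) + (g w - g z - m * (w - z)))%C by ring.
  eapply Rle_trans; [apply Cmod_triangle|]. lra.
Qed.

Lemma Cder_mult (f g : C -> C) (z l m : C) :
  Cder f z l -> Cder g z m ->
  Cder (fun w => f w * g w)%C z (l * g z + f z * m)%C.
Proof.
  intros Hf Hg eps He.
  destruct (Cder_lip _ _ _ Hf) as [d3 [Hd3 H3]].
  destruct (Cder_lip _ _ _ Hg) as [d4 [Hd4 H4]].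
  pose proof (Cmod_ge_0 l) as Pl; pose proof (Cmod_ge_0 m) as Pm.
  pose proof (Cmod_ge_0 (g z)) as Pg; pose proof (Cmod_ge_0 (f z)) as Pf.
  (* Each term of the three-term expansion below receives a third of [eps]; the [+ 1] keeps the
     divisors positive when a value or a derivative vanishes. *)
  set (e1 := eps / 3 / (Cmod (g z) + 1)). set (e2 := eps / 3 / (Cmod (f z) + 1)).
  assert (E1 : e1 * (Cmod (g z) + 1) = eps / 3) by (unfold e1; field; lra).
  assert (E2 : e2 * (Cmod (f z) + 1) = eps / 3) by (unfold e2; field; lra).
  assert (P1 : 0 < e1) by (unfold e1; repeat apply Rdiv_lt_0_compat; lra).
  assert (P2 : 0 < e2) by (unfold e2; repeat apply Rdiv_lt_0_compat; lra).
  destruct (Hf e1 P1) as [d1 [Hd1 H1]]. destruct (Hg e2 P2) as [d2 [Hd2 H2]].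
  set (d5 := eps / 3 / ((Cmod l + 1) * (Cmod m + 1))).
  assert (K0 : 0 < (Cmod l + 1) * (Cmod m + 1)) by (apply Rmult_lt_0_compat; lra).
  assert (E5 : d5 * ((Cmod l + 1) * (Cmod m + 1)) = eps / 3) by (unfold d5; field; lra).
  assert (P5 : 0 < d5) by (unfold d5; repeat apply Rdiv_lt_0_compat; lra).
  exists (Rmin (Rmin d1 d2) (Rmin d5 (Rmin d3 d4))).
  split; [repeat apply Rmin_pos; auto|]. intros w Hw.
  pose proof (Rmin_l (Rmin d1 d2) (Rmin d5 (Rmin d3 d4))).
  pose proof (Rmin_r (Rmin d1 d2) (Rmin d5 (Rmin d3 d4))).
  pose proof (Rmin_l d1 d2); pose proof (Rmin_r d1 d2).
  pose proof (Rmin_l d5 (Rmin d3 d4)); pose proof (Rmin_r d5 (Rmin d3 d4)).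
  pose proof (Rmin_l d3 d4); pose proof (Rmin_r d3 d4).
  specialize (H1 w ltac:(lra)); specialize (H2 w ltac:(lra)).
  specialize (H3 w ltac:(lra)); specialize (H4 w ltac:(lra)).
  replace (f w * g w - f z * g z - (l * g z + f z * m) * (w - z))%C with
    ((f w - f z - l * (w - z)) * g z + f z * (g w - g z - m * (w - z))
     + (f w - f z) * (g w - g z))%C by ring.
  eapply Rle_trans; [apply Cmod_triangle|].
  eapply Rle_trans; [apply Rplus_le_compat_r, Cmod_triangle|].
  rewrite !Cmod_mult.
  pose proof (Cmod_ge_0 (w - z)) as Ph.
  set (h := Cmod (w - z)) in *.
  assert (A1 : Cmod (f w - f z - l * (w - z)) * Cmod (g z) <= eps / 3 * h).
  { rewrite <- E1. apply Rle_trans with (e1 * h * Cmod (g z)).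
    - now apply Rmult_le_compat_r.
    - assert (0 <= e1 * h) by (apply Rmult_le_pos; lra). lra. }
  assert (A2 : Cmod (f z) * Cmod (g w - g z - m * (w - z)) <= eps / 3 * h).
  { rewrite <- E2. apply Rle_trans with (Cmod (f z) * (e2 * h)).
    - now apply Rmult_le_compat_l.
    - assert (0 <= e2 * h) by (apply Rmult_le_pos; lra). lra. }
  assert (A3 : Cmod (f w - f z) * Cmod (g w - g z) <= eps / 3 * h).
  { rewrite <- E5.
    apply Rle_trans with (((Cmod l + 1) * h) * ((Cmod m + 1) * h)).
    - apply Rmult_le_compat; auto using Cmod_ge_0.
    - replace ((Cmod l + 1) * h * ((Cmod m + 1) * h)) with
        ((h * ((Cmod l + 1) * (Cmod m + 1))) * h) by ring.
      apply Rmult_le_compat_r; auto. apply Rmult_le_compat_r; lra. }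
  lra.
Qed.

Lemma Cder_comp (f g : C -> C) (z l m : C) :
  Cder g z l -> Cder f (g z) m -> Cder (fun w => f (g w)) z (m * l)%C.
Proof.
  intros Hg Hf eps He.
  destruct (Cder_lip _ _ _ Hg) as [d3 [Hd3 H3]].
  pose proof (Cmod_ge_0 l) as Pl; pose proof (Cmod_ge_0 m) as Pm.
  set (e1 := eps / 2 / (Cmod l + 1)). set (e2 := eps / 2 / (Cmod m + 1)).
  assert (E1 : e1 * (Cmod l + 1) = eps / 2) by (unfold e1; field; lra).
  assert (E2 : e2 * (Cmod m + 1) = eps / 2) by (unfold e2; field; lra).
  assert (P1 : 0 < e1) by (unfold e1; repeat apply Rdiv_lt_0_compat; lra).
  assert (P2 : 0 < e2) by (unfold e2; repeat apply Rdiv_lt_0_compat; lra).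
  destruct (Hf e1 P1) as [d1 [Hd1 H1]]. destruct (Hg e2 P2) as [d2 [Hd2 H2]].
  set (d5 := d1 / (Cmod l + 1)).
  assert (P5 : 0 < d5) by (unfold d5; apply Rdiv_lt_0_compat; lra).
  assert (E5 : d5 * (Cmod l + 1) = d1) by (unfold d5; field; lra).
  exists (Rmin d5 (Rmin d2 d3)). split; [repeat apply Rmin_pos; auto|]. intros w Hw.
  pose proof (Rmin_l d5 (Rmin d2 d3)); pose proof (Rmin_r d5 (Rmin d2 d3)).
  pose proof (Rmin_l d2 d3); pose proof (Rmin_r d2 d3).
  specialize (H2 w ltac:(lra)); specialize (H3 w ltac:(lra)).
  pose proof (Cmod_ge_0 (w - z)) as Ph.
  assert (B : Cmod (g w - g z) < d1) by nra.
  (* [g w] may equal [g z] although [w] differs from [z]; this is harmless because [Cder] does not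
     exclude the centre. *)
  specialize (H1 (g w) B).
  replace (f (g w) - f (g z) - m * l * (w - z))%C with
    ((f (g w) - f (g z) - m * (g w - g z)) + m * (g w - g z - l * (w - z)))%C by ring.
  eapply Rle_trans; [apply Cmod_triangle|]. rewrite Cmod_mult.
  set (h := Cmod (w - z)) in *.
  assert (A1 : e1 * Cmod (g w - g z) <= eps / 2 * h).
  { rewrite <- E1, Rmult_assoc. apply Rmult_le_compat_l; lra. }
  assert (A2 : Cmod m * Cmod (g w - g z - l * (w - z)) <= eps / 2 * h).
  { rewrite <- E2. apply Rle_trans with (Cmod m * (e2 * h)).
    - now apply Rmult_le_compat_l.
    - assert (0 <= e2 * h) by (apply Rmult_le_pos; lra). lra. }
  lra.
Qed.

Lemma Cder_inv (z : C) : z <> 0 -> Cder Cinv z (- / (z * z))%C.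
Proof.
  intros Hz eps He.
  assert (Pz : 0 < Cmod z) by now apply Cmod_gt_0.
  assert (P3 : 0 < Cmod z * Cmod z * Cmod z) by (repeat apply Rmult_lt_0_compat; auto).
  (* The first bound gives |w| >= |z|/2, so the remainder (w-z)^2/(z^2 w) is at most 2|w-z|^2/|z|^3;
     the second bound makes this at most eps |w-z|. *)
  exists (Rmin (Cmod z / 2) (eps * (Cmod z * Cmod z * Cmod z) / 2)).
  split; [apply Rmin_pos; [lra|]; apply Rdiv_lt_0_compat; [nra|lra]|].
  intros w Hw.
  pose proof (Rmin_l (Cmod z / 2) (eps * (Cmod z * Cmod z * Cmod z) / 2)).
  pose proof (Rmin_r (Cmod z / 2) (eps * (Cmod z * Cmod z * Cmod z) / 2)).
  assert (Hwn : Cmod z / 2 <= Cmod w).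
  { assert (Cmod z <= Cmod (- (w - z)) + Cmod w).
    { replace z with (- (w - z) + w)%C at 1 by ring. apply Cmod_triangle. }
    rewrite Cmod_opp in H1. lra. }
  assert (Hw0 : w <> 0) by (apply Cmod_gt_0; lra).
  replace (/ w - / z - - / (z * z) * (w - z))%C with
    ((w - z) * (w - z) / (z * z * w))%C by (field; auto).
  pose proof (Cmod_ge_0 (w - z)) as Ph.
  rewrite Cmod_div, !Cmod_mult; [|repeat apply Cmult_neq_0; auto].
  set (h := Cmod (w - z)) in *. set (c := Cmod z) in *.
  apply Rle_div_l; [repeat apply Rmult_lt_0_compat; lra|].
  apply Rle_trans with (eps * h * (c * c * (c / 2))).
  - replace (eps * h * (c * c * (c / 2))) with (h * (eps * (c * c * c) / 2)) by field.
    apply Rmult_le_compat_l; lra.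
  - apply Rmult_le_compat_l; [nra|]. apply Rmult_le_compat_l; nra.
Qed.

Definition cexp (z : C) : C := (exp (fst z) * cos (snd z), exp (fst z) * sin (snd z)).

Lemma cexp_plus (z w : C) : cexp (z + w) = (cexp z * cexp w)%C.
Proof.
  unfold cexp, Cmult, Cplus; simpl. rewrite exp_plus, cos_plus, sin_plus. f_equal; ring.
Qed.

Lemma cexp_0 : cexp 0 = 1.
Proof. unfold cexp; simpl. rewrite exp_0, cos_0, sin_0. unfold RtoC; f_equal; ring. Qed.

Lemma Cmod_cexp (z : C) : Cmod (cexp z) = exp (fst z).
Proof.
  unfold Cmod, cexp; simpl fst; simpl snd.
  pose proof (sin2_cos2 (snd z)) as S; unfold Rsqr in S.
  replace ((exp (fst z) * cos (snd z)) ^ 2 + (exp (fst z) * sin (snd z)) ^ 2)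
    with ((exp (fst z)) ^ 2 * (sin (snd z) * sin (snd z) + cos (snd z) * cos (snd z))) by ring.
  rewrite S, Rmult_1_r. apply sqrt_pow2. left; apply exp_pos.
Qed.

Lemma derivable_pt_lim_0_bound (f : R -> R) (l : R) : derivable_pt_lim f 0 l ->
  forall eps, 0 < eps -> exists d, 0 < d /\
    forall h, Rabs h < d -> Rabs (f h - f 0 - l * h) <= eps * Rabs h.
Proof.
  intros H eps He. destruct (H eps He) as [d Hd]. exists d; split; [apply cond_pos|].
  intros h Hh. destruct (Req_dec h 0) as [->|Hn].
  - rewrite Rmult_0_r, !Rminus_diag, Rabs_R0; lra.
  - specialize (Hd h Hn Hh). rewrite Rplus_0_l in Hd.
    replace (f h - f 0 - l * h) with (((f h - f 0) / h - l) * h) by (field; auto).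
    rewrite Rabs_mult. apply Rmult_le_compat_r; [apply Rabs_pos|lra].
Qed.

Lemma Cder_cexp_0 : Cder cexp 0 1.
Proof.
  (* The real and imaginary parts of the error come out at most [4 * e * h] and [5 * e * h], hence
     the ninth. The bound [e <= 1] forces [x <= 1], so that [exp x <= 3]. *)
  intros eps0 He0. set (e := Rmin (eps0 / 9) 1).
  assert (He : 0 < e) by (apply Rmin_pos; lra).
  assert (e <= eps0 / 9) by apply Rmin_l. assert (e <= 1) by apply Rmin_r.
  clearbody e.
  destruct (derivable_pt_lim_0_bound exp 1) with (eps := e) as [d1 [Hd1 H1]]; auto.
  { apply derivable_pt_lim_exp_0. }
  destruct (derivable_pt_lim_0_bound sin 1) with (eps := e) as [d2 [Hd2 H2]]; auto.
  { apply derivable_pt_lim_sin_0. }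
  destruct (derivable_pt_lim_0_bound cos 0) with (eps := e) as [d3 [Hd3 H3]]; auto.
  { replace 0 with (- sin 0) at 2 by (rewrite sin_0; ring). apply derivable_pt_lim_cos. }
  rewrite exp_0 in H1. rewrite sin_0 in H2. rewrite cos_0 in H3.
  exists (Rmin (Rmin d1 d2) (Rmin d3 e)); split; [repeat apply Rmin_pos; auto|].
  intros w Hw. rewrite cexp_0.
  pose proof (Rmin_l (Rmin d1 d2) (Rmin d3 e)); pose proof (Rmin_r (Rmin d1 d2) (Rmin d3 e)).
  pose proof (Rmin_l d1 d2); pose proof (Rmin_r d1 d2).
  pose proof (Rmin_l d3 e); pose proof (Rmin_r d3 e).
  replace (w - 0)%C with w in * by ring.
  replace (cexp w - 1 - 1 * w)%C with (cexp w - 1 - w)%C by ring.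
  destruct w as [x y].
  pose proof (Re_Cmod (x, y)) as Hx; pose proof (Im_Cmod (x, y)) as Hy; simpl in Hx, Hy.
  set (h := Cmod (x, y)) in *.
  specialize (H1 x ltac:(lra)). specialize (H2 y ltac:(lra)). specialize (H3 y ltac:(lra)).
  eapply Rle_trans; [apply Cmod_Re_Im|]. simpl.
  pose proof (Rabs_pos x); pose proof (Rabs_pos y).
  assert (Ex : exp x <= 3).
  { apply Rle_trans with (exp 1); [|apply exp_le_3].
    destruct (Req_dec x 1) as [->|]; [lra|]. left; apply exp_increasing.
    pose proof (Rle_abs x); lra. }
  pose proof (exp_pos x) as Ep.
  assert (A1 : Rabs (exp x * cos y + - (1) + - x) <= 4 * e * h).
  { replace (exp x * cos y + - (1) + - x) with
      ((exp x - 1 - 1 * x) + exp x * (cos y - 1 - 0 * y)) by ring.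
    eapply Rle_trans; [apply Rabs_triang|]. rewrite Rabs_mult, (Rabs_pos_eq (exp x)) by lra.
    assert (exp x * Rabs (cos y - 1 - 0 * y) <= 3 * (e * Rabs y))
      by (apply Rmult_le_compat; auto using Rabs_pos; lra).
    assert (e * Rabs x <= e * h) by (apply Rmult_le_compat_l; lra).
    assert (e * Rabs y <= e * h) by (apply Rmult_le_compat_l; lra). lra. }
  assert (A2 : Rabs (exp x * sin y + - 0 + - y) <= 5 * e * h).
  { replace (exp x * sin y + - 0 + - y) with
      (exp x * (sin y - 0 - 1 * y) + (exp x - 1) * y) by ring.
    eapply Rle_trans; [apply Rabs_triang|]. rewrite !Rabs_mult, (Rabs_pos_eq (exp x)) by lra.
    assert (exp x * Rabs (sin y - 0 - 1 * y) <= 3 * (e * Rabs y))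
      by (apply Rmult_le_compat; auto using Rabs_pos; lra).
    assert (Rabs (exp x - 1) <= 2 * e).
    { replace (exp x - 1) with ((exp x - 1 - 1 * x) + x) by ring.
      eapply Rle_trans; [apply Rabs_triang|].
      assert (e * Rabs x <= 1 * Rabs x) by (apply Rmult_le_compat_r; lra). lra. }
    assert (e * Rabs y <= e * h) by (apply Rmult_le_compat_l; lra).
    assert (Rabs (exp x - 1) * Rabs y <= 2 * e * h)
      by (apply Rmult_le_compat; auto using Rabs_pos; lra). lra. }
  assert (0 <= h) by apply Cmod_ge_0.
  assert (9 * e * h <= eps0 * h) by (apply Rmult_le_compat_r; lra). lra.
Qed.

(** The functional equation [cexp w = cexp z * cexp (w - z)] carries the derivative at 0 to every
    point. *)
Lemma Cder_cexp (z : C) : Cder cexp z (cexp z).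
Proof.
  replace (cexp z) with (RtoC 0 * cexp (z - z) + cexp z * (1 * 1))%C by ring.
  apply Cder_ext_loc with (f := fun w => (cexp z * cexp (w - z))%C) (r := 1); [lra| |].
  - intros w _. rewrite <- cexp_plus. f_equal; ring.
  - apply (Cder_mult (fun _ => cexp z) (fun w => cexp (w - z))); [apply Cder_const|].
    apply (Cder_comp cexp (fun w => w - z)%C).
    + replace (RtoC 1) with (1 + 0)%C by ring.
      apply (Cder_plus (fun w => w) (fun _ => - z)%C); [apply Cder_id|apply Cder_const].
    + replace (z - z)%C with (RtoC 0) by ring. apply Cder_cexp_0.
Qed.

(** * Goursat's theorem on rectangles *)

(** Bisection as an induction principle: if [T] fails on a rectangle, it fails on one of the
    quarters. Repeated choice gives nested bad rectangles shrinking to a point [(p, q)], and there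
    the local hypothesis is contradicted. *)
Lemma rectangle_induction (T : R -> R -> R -> R -> Prop) (a0 b0 c0 d0 : R) :
  a0 <= b0 -> c0 <= d0 ->
  (forall a b c d, a0 <= a -> a <= b -> b <= b0 -> c0 <= c -> c <= d -> d <= d0 ->
    T a ((a + b) / 2) c ((c + d) / 2) -> T ((a + b) / 2) b c ((c + d) / 2) ->
    T a ((a + b) / 2) ((c + d) / 2) d -> T ((a + b) / 2) b ((c + d) / 2) d ->
    T a b c d) ->
  (forall p q, a0 <= p <= b0 -> c0 <= q <= d0 -> exists delta, 0 < delta /\
    forall a b c d, a0 <= a -> a <= p <= b -> b <= b0 -> c0 <= c -> c <= q <= d -> d <= d0 ->
      b - a < delta -> d - c < delta -> T a b c d) ->
  T a0 b0 c0 d0.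
Proof.
  intros Hab Hcd Hquarter Hlocal.
  destruct (excluded_middle_informative (T a0 b0 c0 d0)) as [|Hbad]; [assumption|exfalso].
  pose (bad := fun s : (R * R) * (R * R) =>
    let '((a, b), (c, d)) := s in
    a0 <= a /\ a <= b /\ b <= b0 /\ c0 <= c /\ c <= d /\ d <= d0 /\ ~ T a b c d).
  pose (sub := fun s s' : (R * R) * (R * R) =>
    let '((a, b), (c, d)) := s in let '((a', b'), (c', d')) := s' in
    a <= a' /\ b' <= b /\ c <= c' /\ d' <= d /\
    b' - a' = (b - a) / 2 /\ d' - c' = (d - c) / 2).
  assert (Hstep : forall s : {s | bad s}, exists s' : {s | bad s}, sub (proj1_sig s) (proj1_sig s')).
  { intros [[[a b] [c d]] Hs]; simpl in Hs.
    destruct Hs as (H1 & H2 & H3 & H4 & H5 & H6 & H7).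
    apply NNPP; intros Hno. apply H7.
    assert (Hall : forall a' b' c' d',
      sub ((a, b), (c, d)) ((a', b'), (c', d')) -> T a' b' c' d').
    { intros a' b' c' d' Hsub. apply NNPP; intros HT. apply Hno.
      assert (Hb : bad ((a', b'), (c', d'))) by (simpl in *; repeat split; auto; lra).
      now exists (exist _ _ Hb). }
    apply Hquarter; auto; apply Hall; simpl; repeat split; lra. }
  pose (next := fun s => proj1_sig (constructive_indefinite_description _ (Hstep s))).
  assert (Hnext : forall s, sub (proj1_sig s) (proj1_sig (next s)))
    by (intros s; exact (proj2_sig (constructive_indefinite_description _ (Hstep s)))).
  assert (Hb0 : bad ((a0, b0), (c0, d0))) by (simpl; repeat split; auto; lra).
  pose (st := fun n => Nat.iter n next (exist _ _ Hb0)).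
  pose (al := fun n => fst (fst (proj1_sig (st n)))).
  pose (be := fun n => snd (fst (proj1_sig (st n)))).
  pose (ga := fun n => fst (snd (proj1_sig (st n)))).
  pose (de := fun n => snd (snd (proj1_sig (st n)))).
  assert (Hbd : forall n, a0 <= al n /\ al n <= be n /\ be n <= b0 /\
     c0 <= ga n /\ ga n <= de n /\ de n <= d0 /\ ~ T (al n) (be n) (ga n) (de n)).
  { intros n. unfold al, be, ga, de. destruct (st n) as [[[a b] [c d]] Hs]. exact Hs. }
  assert (Hsb : forall n, al n <= al (S n) /\ be (S n) <= be n /\
     ga n <= ga (S n) /\ de (S n) <= de n /\
     be (S n) - al (S n) = (be n - al n) / 2 /\ de (S n) - ga (S n) = (de n - ga n) / 2).
  { intros n. unfold al, be, ga, de. change (st (S n)) with (next (st n)).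
    pose proof (Hnext (st n)) as Hn. unfold sub in Hn.
    destruct (proj1_sig (st n)) as [[a b] [c d]].
    destruct (proj1_sig (next (st n))) as [[a' b'] [c' d']]. exact Hn. }
  assert (Hwidth : forall n, be n - al n = (b0 - a0) * (/ 2) ^ n /\
                             de n - ga n = (d0 - c0) * (/ 2) ^ n).
  { induction n as [|n [I1 I2]]; [unfold al, be, ga, de; simpl; lra|].
    destruct (Hsb n) as (_ & _ & _ & _ & E1 & E2). rewrite E1, E2, I1, I2; simpl; lra. }
  assert (Hlim : forall (u v : nat -> R), (forall n, u n <= u (S n)) ->
     (forall n, v (S n) <= v n) -> (forall n, u n <= v n) ->
     exists p, forall n, u n <= p <= v n).
  { intros u v Hu Hv Huv.
    assert (Um : forall n k, u n <= u (n + k)%nat).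
    { intros n k; induction k as [|k IH]; [rewrite Nat.add_0_r; lra|].
      rewrite Nat.add_succ_r. specialize (Hu (n + k)%nat); lra. }
    assert (Vm : forall n k, v (n + k)%nat <= v n).
    { intros n k; induction k as [|k IH]; [rewrite Nat.add_0_r; lra|].
      rewrite Nat.add_succ_r. specialize (Hv (n + k)%nat); lra. }
    assert (UV : forall n m, u n <= v m).
    { intros n m. apply Rle_trans with (u (n + m)%nat); [apply Um|].
      apply Rle_trans with (v (n + m)%nat); [apply Huv|]. rewrite Nat.add_comm; apply Vm. }
    destruct (completeness (fun x => exists n, x = u n)) as [p [Hp1 Hp2]].
    - exists (v 0%nat). intros x [n ->]. apply UV.
    - exists (u 0%nat); now exists 0%nat.
    - exists p. intros n; split; [apply Hp1; now exists n|].
      apply Hp2. intros x [m ->]. apply UV. }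
  destruct (Hlim al be) as [p Hp]; [intros n; apply Hsb|intros n; apply Hsb|intros n; apply Hbd|].
  destruct (Hlim ga de) as [q Hq]; [intros n; apply Hsb|intros n; apply Hsb|intros n; apply Hbd|].
  pose proof (Hp 0%nat) as Hp0; pose proof (Hq 0%nat) as Hq0.
  destruct (Hlocal p q Hp0 Hq0) as [delta [Hdelta HT]].
  (* [W] exceeds both sides, and the [+ 1] keeps it positive for a degenerate rectangle; both sides
     at stage [N] are then below [W * (/ 2) ^ N < delta]. *)
  set (W := (b0 - a0) + (d0 - c0) + 1).
  destruct (pow_lt_1_zero (/ 2)) with (y := delta / W) as [N HN].
  { rewrite Rabs_pos_eq; lra. }
  { apply Rdiv_lt_0_compat; unfold W; lra. }
  specialize (HN N (Nat.le_refl N)).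
  assert (Hpw : 0 < (/ 2) ^ N) by (apply pow_lt; lra).
  rewrite Rabs_pos_eq in HN by lra.
  assert (HW : W * (/ 2) ^ N < delta).
  { rewrite Rmult_comm. apply Rlt_div_r; [unfold W; lra|exact HN]. }
  unfold W in HW.
  destruct (Hwidth N) as [W1 W2].
  destruct (Hbd N) as (B1 & B2 & B3 & B4 & B5 & B6 & B7).
  apply B7, HT; auto; nra.
Qed.

(** The counterclockwise line integral of the 1-form P dx + Q dy. *)
Definition boundary_integral (P Q : R -> R -> R) (a b c d : R) : R :=
  RInt (fun x => P x c) a b + RInt (fun y => Q b y) c d
  - RInt (fun x => P x d) a b - RInt (fun y => Q a y) c d.

(* The common coefficient [B] expresses [dP/dy = dQ/dx]. *)
Definition closed_at (P Q : R -> R -> R) (p q : R) : Prop :=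
  exists A B D, forall eps, 0 < eps -> exists delta, 0 < delta /\
    forall x y, Rabs (x - p) < delta -> Rabs (y - q) < delta ->
      Rabs (P x y - P p q - A * (x - p) - B * (y - q)) <= eps * (Rabs (x - p) + Rabs (y - q)) /\
      Rabs (Q x y - Q p q - B * (x - p) - D * (y - q)) <= eps * (Rabs (x - p) + Rabs (y - q)).

Lemma is_derive_of_error (f : R -> R) (p A : R) :
  (forall eps, 0 < eps -> exists delta, 0 < delta /\ forall x, Rabs (x - p) < delta ->
     Rabs (f x - f p - A * (x - p)) <= eps * Rabs (x - p)) ->
  is_derive f p A.
Proof.
  intros H. apply is_derive_Reals.
  intros eps He. destruct (H (eps / 2)) as [d [Hd Hx]]; [lra|].
  exists (mkposreal d Hd); simpl. intros h Hh Hhd.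
  specialize (Hx (p + h)). replace (p + h - p) with h in Hx by ring.
  specialize (Hx Hhd).
  replace ((f (p + h) - f p) / h - A) with ((f (p + h) - f p - A * h) / h) by (field; auto).
  unfold Rdiv; rewrite Rabs_mult, Rabs_inv. pose proof (Rabs_pos_lt h Hh).
  apply Rle_lt_trans with (eps / 2); [|lra].
  apply Rle_div_l; auto.
Qed.

Lemma continuous_of_error (f : R -> R) (p A : R) :
  (forall eps, 0 < eps -> exists delta, 0 < delta /\ forall x, Rabs (x - p) < delta ->
     Rabs (f x - f p - A * (x - p)) <= eps * Rabs (x - p)) ->
  continuous f p.
Proof.
  intros H. apply (ex_derive_continuous (K := R_AbsRing) (V := R_NormedModule)).
  exists A. now apply is_derive_of_error.
Qed.

Lemma RInt_near_const (F : R -> R) (a b k e : R) :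
  a <= b -> ex_RInt F a b -> (forall x, a <= x <= b -> Rabs (F x - k) <= e) ->
  Rabs (RInt F a b - (b - a) * k) <= (b - a) * e.
Proof.
  intros Hab HF He.
  replace (RInt F a b - (b - a) * k) with (RInt (fun x => minus (F x) k) a b).
  - apply abs_RInt_le_const; auto. apply (ex_RInt_minus F (fun _ => k)); auto. apply ex_RInt_const.
  - rewrite (RInt_minus F (fun _ => k)); auto; [|apply ex_RInt_const].
    rewrite RInt_const. reflexivity.
Qed.

Section Goursat.

Variables (P Q : R -> R -> R) (a0 b0 c0 d0 : R).
Hypothesis closed : forall p q, a0 <= p <= b0 -> c0 <= q <= d0 -> closed_at P Q p q.

(** On a horizontal line the [B] term and the [y] part of the error vanish, so [P] is differentiable
    along it, hence continuous and integrable; likewise [Q] along vertical lines. *)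
Lemma closed_ex_RInt :
  (forall a b y, a0 <= a -> a <= b -> b <= b0 -> c0 <= y <= d0 -> ex_RInt (fun x => P x y) a b) /\
  (forall c d x, c0 <= c -> c <= d -> d <= d0 -> a0 <= x <= b0 -> ex_RInt (fun y => Q x y) c d).
Proof.
  split.
  - intros a b y Ha Hab Hb Hy. apply (ex_RInt_continuous (V := R_CompleteNormedModule)).
    intros z. rewrite Rmin_left, Rmax_right by lra. intros Hz.
    destruct (closed z y) as [A [B [D H]]]; [lra|lra|].
    apply (continuous_of_error (fun x => P x y) z A).
    intros eps He. destruct (H eps He) as [delta [Hd HE]]. exists delta; split; auto.
    intros x Hx. destruct (HE x y) as [E _]; auto; [rewrite Rminus_diag, Rabs_R0; lra|].
    rewrite Rminus_diag, Rabs_R0, Rmult_0_r, Rminus_0_r, Rplus_0_r in E. exact E.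
  - intros c d x Hc Hcd Hd Hx. apply (ex_RInt_continuous (V := R_CompleteNormedModule)).
    intros z. rewrite Rmin_left, Rmax_right by lra. intros Hz.
    destruct (closed x z) as [A [B [D H]]]; [lra|lra|].
    apply (continuous_of_error (fun y => Q x y) z D).
    intros eps He. destruct (H eps He) as [delta [Hdl HE]]. exists delta; split; auto.
    intros y Hy. destruct (HE x y) as [_ E]; auto; [rewrite Rminus_diag, Rabs_R0; lra|].
    rewrite Rminus_diag, Rabs_R0, Rmult_0_r, Rminus_0_r, Rplus_0_l in E. exact E.
Qed.

(** Each inner edge is traversed once in either direction, so its contributions cancel. *)
Lemma boundary_integral_quarter (a b c d : R) :
  a0 <= a -> a <= b -> b <= b0 -> c0 <= c -> c <= d -> d <= d0 ->
  boundary_integral P Q a b c d =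
    boundary_integral P Q a ((a + b) / 2) c ((c + d) / 2)
  + boundary_integral P Q ((a + b) / 2) b c ((c + d) / 2)
  + boundary_integral P Q a ((a + b) / 2) ((c + d) / 2) d
  + boundary_integral P Q ((a + b) / 2) b ((c + d) / 2) d.
Proof.
  intros H1 H2 H3 H4 H5 H6. destruct closed_ex_RInt as [exP exQ].
  unfold boundary_integral.
  assert (SP : forall y, c0 <= y <= d0 -> RInt (fun x => P x y) a b =
    RInt (fun x => P x y) a ((a + b) / 2) + RInt (fun x => P x y) ((a + b) / 2) b).
  { intros y Hy. symmetry. apply (RInt_Chasles (fun x => P x y)); apply exP; lra. }
  assert (SQ : forall x, a0 <= x <= b0 -> RInt (fun y => Q x y) c d =
    RInt (fun y => Q x y) c ((c + d) / 2) + RInt (fun y => Q x y) ((c + d) / 2) d).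
  { intros x Hx. symmetry. apply (RInt_Chasles (fun y => Q x y)); apply exQ; lra. }
  rewrite (SP c), (SP d), (SQ a), (SQ b) by lra. ring.
Qed.

(* Near [(p, q)] the differences [P x c - P x d] and [Q b y - Q a y] are
   [B (c - d)] and [B (b - a)] up to a small error, and these main terms cancel. *)
Lemma boundary_integral_local (p q K : R) :
  a0 <= p <= b0 -> c0 <= q <= d0 -> 0 < K -> exists delta, 0 < delta /\
  forall a b c d, a0 <= a -> a <= p <= b -> b <= b0 -> c0 <= c -> c <= q <= d -> d <= d0 ->
    b - a < delta -> d - c < delta ->
    Rabs (boundary_integral P Q a b c d) <= K * ((b - a) + (d - c)) ^ 2.
Proof.
  intros Hp Hq HK. destruct closed_ex_RInt as [exP exQ].
  destruct (closed p q Hp Hq) as [A [B [D H]]].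
  (* Half of [K], because each estimate below subtracts two expansions at [(p, q)] and so doubles
     the error. *)
  destruct (H (K / 2)) as [delta [Hdelta E]]; [lra|]. exists delta; split; auto.
  intros a b c d H1 H2 H3 H4 H5 H6 H7 H8.
  set (L := (b - a) + (d - c)).
  assert (HE : forall x y, a <= x <= b -> c <= y <= d ->
    Rabs (P x y - P p q - A * (x - p) - B * (y - q)) <= K / 2 * L /\
    Rabs (Q x y - Q p q - B * (x - p) - D * (y - q)) <= K / 2 * L).
  { intros x y Hx Hy.
    assert (Bx : Rabs (x - p) <= b - a) by (apply Rabs_le; lra).
    assert (By : Rabs (y - q) <= d - c) by (apply Rabs_le; lra).
    destruct (E x y) as [E1 E2]; [lra|lra|].
    assert (K / 2 * (Rabs (x - p) + Rabs (y - q)) <= K / 2 * L)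
      by (apply Rmult_le_compat_l; unfold L; lra). lra. }
  assert (I1 : Rabs ((RInt (fun x => P x c) a b - RInt (fun x => P x d) a b)
                     - (b - a) * (B * (c - d))) <= (b - a) * (K * L)).
  { assert (X1 : ex_RInt (fun x => P x c) a b) by (apply exP; lra).
    assert (X2 : ex_RInt (fun x => P x d) a b) by (apply exP; lra).
    pose proof (RInt_minus _ _ _ _ X1 X2) as RM.
    unfold minus, plus, opp in RM; simpl in RM.
    unfold Rminus at 2; rewrite <- RM.
    apply RInt_near_const; [lra|exact (ex_RInt_minus _ _ _ _ X1 X2)|].
    intros x Hx. destruct (HE x c) as [F1 _]; [lra|lra|]. destruct (HE x d) as [F2 _]; [lra|lra|].
    replace (P x c + - P x d - B * (c - d)) with
      ((P x c - P p q - A * (x - p) - B * (c - q))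
       - (P x d - P p q - A * (x - p) - B * (d - q))) by ring.
    eapply Rle_trans; [apply Rabs_triang|]. rewrite Rabs_Ropp. lra. }
  assert (I2 : Rabs ((RInt (fun y => Q b y) c d - RInt (fun y => Q a y) c d)
                     - (d - c) * (B * (b - a))) <= (d - c) * (K * L)).
  { assert (X1 : ex_RInt (fun y => Q b y) c d) by (apply exQ; lra).
    assert (X2 : ex_RInt (fun y => Q a y) c d) by (apply exQ; lra).
    pose proof (RInt_minus _ _ _ _ X1 X2) as RM.
    unfold minus, plus, opp in RM; simpl in RM.
    unfold Rminus at 2; rewrite <- RM.
    apply RInt_near_const; [lra|exact (ex_RInt_minus _ _ _ _ X1 X2)|].
    intros y Hy. destruct (HE b y) as [_ F1]; [lra|lra|]. destruct (HE a y) as [_ F2]; [lra|lra|].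
    replace (Q b y + - Q a y - B * (b - a)) with
      ((Q b y - Q p q - B * (b - p) - D * (y - q))
       - (Q a y - Q p q - B * (a - p) - D * (y - q))) by ring.
    eapply Rle_trans; [apply Rabs_triang|]. rewrite Rabs_Ropp. lra. }
  unfold boundary_integral.
  match goal with |- Rabs ?X <= _ => replace X with
    (((RInt (fun x => P x c) a b - RInt (fun x => P x d) a b) - (b - a) * (B * (c - d))) +
     ((RInt (fun y => Q b y) c d - RInt (fun y => Q a y) c d) - (d - c) * (B * (b - a)))) by ring end.
  eapply Rle_trans; [apply Rabs_triang|]. fold L.
  replace (K * L ^ 2) with ((b - a) * (K * L) + (d - c) * (K * L)) by (unfold L; ring). lra.
Qed.

(** The bound [K] times the squared half-perimeter passes from quarters to the whole without loss:
    halved sides give a quarter of the square, and there are four of them. As [K] is arbitrary, the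
    integral vanishes. *)
Theorem Goursat_rectangle : a0 <= b0 -> c0 <= d0 -> boundary_integral P Q a0 b0 c0 d0 = 0.
Proof.
  intros Hab Hcd.
  assert (HK : forall K, 0 < K ->
    Rabs (boundary_integral P Q a0 b0 c0 d0) <= K * ((b0 - a0) + (d0 - c0)) ^ 2).
  { intros K HK.
    apply (rectangle_induction (fun a b c d =>
      Rabs (boundary_integral P Q a b c d) <= K * ((b - a) + (d - c)) ^ 2)); auto.
    - intros a b c d H1 H2 H3 H4 H5 H6 T1 T2 T3 T4.
      rewrite boundary_integral_quarter by auto.
      eapply Rle_trans; [apply Rabs_triang|].
      eapply Rle_trans; [apply Rplus_le_compat_r, Rabs_triang|].
      eapply Rle_trans; [apply Rplus_le_compat_r, Rplus_le_compat_r, Rabs_triang|].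
      eapply Rle_trans;
        [apply Rplus_le_compat; [apply Rplus_le_compat; [apply Rplus_le_compat|]|]; eassumption|].
      right; field.
    - intros p q Hp Hq. now apply boundary_integral_local. }
  set (W := ((b0 - a0) + (d0 - c0)) ^ 2) in *.
  assert (HW : 0 <= W) by apply pow2_ge_0.
  destruct (Req_dec (boundary_integral P Q a0 b0 c0 d0) 0) as [|Hn]; auto. exfalso.
  apply Rabs_pos_lt in Hn. set (w := Rabs (boundary_integral P Q a0 b0 c0 d0)) in *.
  specialize (HK (w / (2 * (W + 1))) ltac:(apply Rdiv_lt_0_compat; lra)).
  assert (E : w / (2 * (W + 1)) * (W + 1) = w / 2) by (field; lra).
  assert (0 < w / (2 * (W + 1))) by (apply Rdiv_lt_0_compat; lra). nra.
Qed.

End Goursat.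

(** * Cauchy's estimate *)

(** With H = u + iv, the form v dx + u dy is Im(H dz), and its closedness is the Cauchy-Riemann
    equation v_y = u_x, with common value Re l. *)
Lemma Cder_closed_at (H : C -> C) (p q : R) (l : C) : Cder H (p, q) l ->
  closed_at (fun x y => snd (H (x, y))) (fun x y => fst (H (x, y))) p q.
Proof.
  intros HH. exists (snd l), (fst l), (- snd l). intros eps He.
  destruct (HH eps He) as [d [Hd E]]. exists (d / 2); split; [lra|]. intros x y Hx Hy.
  pose proof (Cmod_Re_Im ((x, y) - (p, q))) as B. simpl in B.
  specialize (E (x, y)). specialize (E ltac:(unfold Rminus in Hx, Hy; lra)).
  set (Z := (H (x, y) - H (p, q) - l * ((x, y) - (p, q)))%C) in *.
  assert (Cmod Z <= eps * (Rabs (x - p) + Rabs (y - q))).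
  { eapply Rle_trans; [exact E|]. apply Rmult_le_compat_l; [lra|exact B]. }
  split.
  - eapply Rle_trans; [|exact H0]. eapply Rle_trans; [|apply Im_Cmod].
    right; f_equal. unfold Z; simpl; ring.
  - eapply Rle_trans; [|exact H0]. eapply Rle_trans; [|apply Re_Cmod].
    right; f_equal. unfold Z; simpl; ring.
Qed.

(** Periodicity makes the two horizontal sides cancel in Goursat's theorem, which leaves the two
    vertical ones. *)
Lemma RInt_vertical_side (H : C -> C) (a b T : R) :
  a <= b -> 0 <= T ->
  (forall p q, a <= p <= b -> 0 <= q <= T -> exists l, Cder H (p, q) l) ->
  (forall x, H (x, T) = H (x, 0)) ->
  RInt (fun y => fst (H (b, y))) 0 T = RInt (fun y => fst (H (a, y))) 0 T.
Proof.
  intros Hab HT Hd Hper.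
  assert (G : boundary_integral (fun x y => snd (H (x, y))) (fun x y => fst (H (x, y))) a b 0 T = 0).
  { apply Goursat_rectangle; auto. intros p q Hp Hq.
    destruct (Hd p q Hp Hq) as [l Hl]. now apply Cder_closed_at with l. }
  unfold boundary_integral in G.
  rewrite (RInt_ext (fun x => snd (H (x, T))) (fun x => snd (H (x, 0)))) in G by
    (intros x _; now rewrite Hper).
  lra.
Qed.

Lemma ex_RInt_vertical (H : C -> C) (a T : R) :
  0 <= T -> (forall q, 0 <= q <= T -> exists l, Cder H (a, q) l) ->
  ex_RInt (fun y => fst (H (a, y))) 0 T.
Proof.
  intros HT Hd.
  (* A rectangle of width zero suffices here. *)
  apply (closed_ex_RInt (fun x y => snd (H (x, y))) (fun x y => fst (H (x, y))) a a 0 T); try lra.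
  intros p q Hp Hq. replace p with a by lra.
  destruct (Hd q Hq) as [l Hl]. now apply Cder_closed_at with l.
Qed.

(* In the logarithmic coordinate [zeta = z0 + exp w] the difference quotient
   [(g zeta - g z0) / (zeta - z0)] is differentiable and [2 i pi]-periodic, so by
   Goursat's theorem its mean over a circle does not depend on the radius; the
   mean over small circles tends to [l]. *)
Lemma Re_Cauchy_estimate (g : C -> C) (z0 l : C) (r R0 M : R) :
  0 < r < R0 ->
  (forall z : C, Cmod (z - z0) < R0 -> exists m, Cder g z m) ->
  (forall z : C, Cmod (z - z0) = r -> Cmod (g z) <= M) ->
  Cder g z0 l -> fst l <= M / r.
Proof.
  intros [Hr HR] Hg HM Hl.
  pose proof PI_RGT_0 as HPI.
  set (H := fun w : C => ((g (z0 + cexp w) - g z0) * cexp (- w))%C).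
  assert (Hinv : forall w, (cexp w * cexp (- w))%C = 1).
  { intros w. rewrite <- cexp_plus. replace (w + - w)%C with (RtoC 0) by ring. apply cexp_0. }
  assert (HH : forall w : C, exp (fst w) < R0 -> exists m, Cder H w m).
  { intros w Hw. destruct (Hg (z0 + cexp w)%C) as [m Hm].
    { replace (z0 + cexp w - z0)%C with (cexp w) by ring. now rewrite Cmod_cexp. }
    eexists. apply (Cder_mult (fun w => g (z0 + cexp w) - g z0)%C (fun w => cexp (- w))).
    - apply (Cder_plus (fun w => g (z0 + cexp w)%C) (fun _ => - g z0)%C); [|apply Cder_const].
      apply (Cder_comp g (fun w => z0 + cexp w)%C); [|exact Hm].
      apply (Cder_plus (fun _ => z0) cexp); [apply Cder_const|apply Cder_cexp].
    - apply (Cder_comp cexp Copp); [|apply Cder_cexp].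
      apply Cder_ext_loc with (f := fun w => (- (1) * w)%C) (r := 1); [lra|intros; ring|].
      apply (Cder_mult (fun _ => - (1))%C (fun w => w)); [apply Cder_const|apply Cder_id]. }
  assert (Hper : forall x, H (x, 2 * PI) = H (x, 0)).
  { intros x. unfold H.
    assert (E : forall y, cexp (y, 2 * PI) = cexp (y, 0)).
    { intros y. unfold cexp; simpl. now rewrite cos_2PI, sin_2PI, cos_0, sin_0. }
    assert (E' : forall y, cexp (- (y, 2 * PI)) = cexp (- (y, 0))).
    { intros y. unfold cexp; simpl. now rewrite !cos_neg, !sin_neg, cos_2PI, sin_2PI, cos_0, sin_0. }
    now rewrite E, E'. }
  assert (Hexp : exp (ln r) = r) by now apply exp_ln.
  (* Bounding [g zeta - g z0] pointwise would lose a constant. Instead the contribution of [g z0],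
     namely [(A * cos y + B * sin y) / r], is kept exactly: it integrates to 0 over a period, and
     only the [g zeta] part is estimated by [M / r]. *)
  assert (Hup : RInt (fun y => fst (H (ln r, y))) 0 (2 * PI) <= 2 * PI * (M / r)).
  { set (A := fst (g z0)). set (B := snd (g z0)).
    assert (I : is_RInt (fun y => M / r - (A * cos y + B * sin y) / r) 0 (2 * PI) (2 * PI * (M / r))).
    { set (F := fun y => M / r * y - (A * sin y - B * cos y) / r).
      replace (2 * PI * (M / r)) with (minus (F (2 * PI)) (F 0)).
      - apply (is_RInt_derive (V := R_CompleteNormedModule) F); unfold F.
        + intros y _. auto_derive; [auto|]. field; lra.
        + intros y _. apply (ex_derive_continuous (K := R_AbsRing) (V := R_NormedModule)).
          auto_derive; auto.
      - unfold minus, plus, opp, F; simpl. rewrite cos_2PI, sin_2PI, cos_0, sin_0. field; lra. }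
    rewrite <- (is_RInt_unique _ _ _ _ I). apply RInt_le; [lra| |eexists; exact I|].
    - apply ex_RInt_vertical; [lra|]. intros q _. apply HH; simpl; lra.
    - intros y _. set (w := (ln r, y) : C).
      assert (Ew : Cmod (cexp w) = r) by (rewrite Cmod_cexp; exact Hexp).
      assert (Ew' : Cmod (cexp (- w)) = / r).
      { rewrite Cmod_cexp. simpl. now rewrite exp_Ropp, Hexp. }
      assert (EH : fst (H w) = fst (g (z0 + cexp w) * cexp (- w))%C - (A * cos y + B * sin y) / r).
      { unfold H. replace ((g (z0 + cexp w) - g z0) * cexp (- w))%C with
          (g (z0 + cexp w)%C * cexp (- w) - g z0 * cexp (- w))%C by ring.
        unfold Cminus; simpl. fold A B. rewrite exp_Ropp, Hexp, cos_neg, sin_neg. field; lra. }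
      rewrite EH.
      pose proof (Re_Cmod (g (z0 + cexp w) * cexp (- w))%C) as B1.
      rewrite Cmod_mult, Ew' in B1.
      assert (B2 : Cmod (g (z0 + cexp w)%C) <= M).
      { apply HM. replace (z0 + cexp w - z0)%C with (cexp w) by ring. exact Ew. }
      assert (B3 : Cmod (g (z0 + cexp w)%C) * / r <= M / r).
      { apply Rmult_le_compat_r; auto. left; now apply Rinv_0_lt_compat. }
      pose proof (Rle_abs (fst (g (z0 + cexp w) * cexp (- w))%C)). lra. }
  apply Rnot_lt_le; intros Hlt.
  (* Half of the supposed gap: a mean within [e] of [fst l] still exceeds [M / r]. *)
  set (e := (fst l - M / r) / 2). assert (He : 0 < e) by (unfold e; lra).
  destruct (Hl e He) as [d [Hd HE]].
  (* A radius below [d], so that the expansion at [z0] holds on the circle, and below [r], so that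
     [ln t <= ln r]. *)
  set (t := Rmin d r / 2).
  assert (Hm : 0 < Rmin d r) by (apply Rmin_pos; lra).
  pose proof (Rmin_l d r); pose proof (Rmin_r d r).
  assert (Ht : exp (ln t) = t) by (apply exp_ln; unfold t; lra).
  assert (Htr : ln t <= ln r) by (left; apply ln_increasing; unfold t; lra).
  assert (Hlow : Rabs (RInt (fun y => fst (H (ln t, y))) 0 (2 * PI) - (2 * PI - 0) * fst l)
                 <= (2 * PI - 0) * e).
  { apply RInt_near_const; [lra| |].
    - apply ex_RInt_vertical; [lra|]. intros q _. apply HH; simpl. unfold t in *; lra.
    - intros y _. set (w := (ln t, y) : C).
      assert (Ew : Cmod (cexp w) = t) by (rewrite Cmod_cexp; exact Ht).
      replace (fst (H w) - fst l) with (fst (H w - l)%C) by (simpl; ring).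
      eapply Rle_trans; [apply Re_Cmod|].
      replace (H w - l)%C with
        ((g (z0 + cexp w) - g z0 - l * (z0 + cexp w - z0)) * cexp (- w))%C.
      2:{ unfold H. transitivity ((g (z0 + cexp w) - g z0) * cexp (- w) - l * (cexp w * cexp (- w)))%C;
          [ring|]. rewrite Hinv; ring. }
      rewrite Cmod_mult, Cmod_cexp. simpl fst. rewrite exp_Ropp, Ht.
      specialize (HE (z0 + cexp w)%C). replace (Cmod (z0 + cexp w - z0)) with t in HE.
      2:{ replace (z0 + cexp w - z0)%C with (cexp w) by ring. auto. }
      specialize (HE ltac:(unfold t; lra)).
      assert (0 < t) by (unfold t; lra).
      apply Rle_div_l; [auto|]. exact HE. }
  rewrite <- (RInt_vertical_side H (ln t) (ln r) (2 * PI)) in Hlow; auto; [|lra|].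
  - apply Rabs_le_between in Hlow.
    assert (2 * PI * (fst l - e) <= 2 * PI * (M / r)) by lra.
    apply Rmult_le_reg_l in H2; [|lra]. unfold e in H2. lra.
  - intros p q Hp _. apply HH. simpl.
    apply Rle_lt_trans with r; [|lra]. rewrite <- Hexp.
    destruct (Req_dec p (ln r)) as [->|]; [lra|]. left; apply exp_increasing; lra.
Qed.

(** Rotating [z] onto the nonnegative real axis turns its modulus into a real part, so that
    estimates proved for real parts apply to moduli. *)
Lemma unimodular_multiplier (z : C) : exists c, Cmod c = 1 /\ (c * z)%C = Cmod z.
Proof.
  destruct (Req_dec (Cmod z) 0) as [E|E].
  - exists 1. rewrite Cmod_1, E. apply Cmod_eq_0 in E. subst. split; [auto|ring].
  - assert (E' : RtoC (Cmod z) <> 0) by (intros K; apply E; now apply RtoC_inj).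
    exists (Cconj z / Cmod z)%C. split.
    + rewrite Cmod_div, Cmod_conj, Cmod_R, Rabs_pos_eq by auto using Cmod_ge_0. field; auto.
    + transitivity ((z * Cconj z) / Cmod z)%C; [field; auto|].
      rewrite <- Cmod2_conj. replace (RtoC (Cmod z ^ 2)) with (RtoC (Cmod z) * RtoC (Cmod z))%C
        by (rewrite <- RtoC_mult; f_equal; ring).
      field; auto.
Qed.

Theorem Cauchy_estimate (g : C -> C) (z0 l : C) (r R0 M : R) :
  0 < r < R0 ->
  (forall z : C, Cmod (z - z0) < R0 -> exists m, Cder g z m) ->
  (forall z : C, Cmod (z - z0) = r -> Cmod (g z) <= M) ->
  Cder g z0 l -> Cmod l <= M / r.
Proof.
  intros Hr Hg HM Hl. destruct (unimodular_multiplier l) as [c [Hc Ec]].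
  assert (Hcg : forall z m, Cder g z m -> Cder (fun w => c * g w)%C z (c * m)%C).
  { intros z m Hm. replace (c * m)%C with (0 * g z + c * m)%C by ring.
    apply (Cder_mult (fun _ => c)); [apply Cder_const|auto]. }
  replace (Cmod l) with (fst (c * l)%C) by (rewrite Ec; reflexivity).
  apply (Re_Cauchy_estimate (fun w => c * g w)%C z0 _ r R0); auto.
  - intros z Hz. destruct (Hg z Hz) as [m Hm]. eauto.
  - intros z Hz. rewrite Cmod_mult, Hc. rewrite Rmult_1_l; auto.
Qed.

(** * From derivative bounds to Lipschitz bounds *)

Lemma Cder_real_axis (G : C -> C) (t : R) (L : C) :
  Cder G (RtoC t) L -> is_derive (fun s : R => fst (G (RtoC s))) t (fst L).
Proof.
  intros H. apply is_derive_of_error. intros eps He. destruct (H eps He) as [d [Hd HE]].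
  exists d; split; auto. intros x Hx. specialize (HE (RtoC x)).
  replace (RtoC x - RtoC t)%C with (RtoC (x - t)) in HE by (now rewrite RtoC_minus).
  rewrite Cmod_R in HE. specialize (HE Hx).
  eapply Rle_trans; [|exact HE]. eapply Rle_trans; [|apply Re_Cmod].
  right; f_equal. simpl. ring.
Qed.

(** The mean value theorem fails for complex values. After rotation by [c] the increment [g z - g w]
    is real and nonnegative, and the real theorem applies to the real part of [c * g] along the
    segment from [w] to [z]. *)
Lemma Lipschitz_of_bounded_derivative (g : C -> C) (z0 : C) (s K : R) :
  (forall z : C, Cmod (z - z0) < s -> exists l, Cder g z l /\ Cmod l <= K) ->
  forall z w : C, Cmod (z - z0) < s -> Cmod (w - z0) < s ->
  Cmod (g z - g w) <= K * Cmod (z - w).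
Proof.
  intros Hg z w Hz Hw.
  destruct (unimodular_multiplier (g z - g w)) as [c [Hc Ec]].
  set (G := fun t : C => (c * g (w + t * (z - w)))%C).
  set (phi := fun t : R => fst (G (RtoC t))).
  assert (Hphi : forall t, 0 <= t <= 1 ->
    exists m, is_derive phi t m /\ m <= K * Cmod (z - w)).
  { intros t Ht. destruct (Hg (w + t * (z - w))%C) as [l [Hl Kl]].
    { replace (w + t * (z - w) - z0)%C with (RtoC t * (z - z0) + RtoC (1 - t) * (w - z0))%C
        by (rewrite RtoC_minus; ring).
      eapply Rle_lt_trans; [apply Cmod_triangle|].
      rewrite !Cmod_mult, !Cmod_R, !Rabs_pos_eq by lra.
      (* At [t = 0] strictness must come from [w]; for [t > 0] it comes from [z]. *)
      destruct (Req_dec t 0) as [->|]; [lra|].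
      assert (t * Cmod (z - z0) < t * s) by (apply Rmult_lt_compat_l; lra).
      assert ((1 - t) * Cmod (w - z0) <= (1 - t) * s) by (apply Rmult_le_compat_l; lra). lra. }
    exists (fst (c * (l * (z - w)))%C). split.
    - apply Cder_real_axis.
      replace (c * (l * (z - w)))%C with
        (0 * g (w + t * (z - w)) + c * (l * (0 + (1 * (z - w) + t * 0))))%C by ring.
      apply (Cder_mult (fun _ => c) (fun t => g (w + t * (z - w))%C)); [apply Cder_const|].
      apply (Cder_comp g (fun t => w + t * (z - w))%C); [|exact Hl].
      apply (Cder_plus (fun _ => w) (fun t => t * (z - w))%C); [apply Cder_const|].
      apply (Cder_mult (fun t => t) (fun _ => (z - w)%C)); [apply Cder_id|apply Cder_const].
    - eapply Rle_trans; [apply Rle_abs|]. eapply Rle_trans; [apply Re_Cmod|].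
      rewrite !Cmod_mult, Hc, Rmult_1_l. apply Rmult_le_compat_r; auto using Cmod_ge_0. }
  destruct (MVT_gen phi 0 1 (Derive phi)) as [t [Ht E]].
  - intros t. rewrite Rmin_left, Rmax_right by lra. intros Ht.
    destruct (Hphi t) as [m [Hm _]]; [lra|]. apply Derive_correct. now exists m.
  - intros t. rewrite Rmin_left, Rmax_right by lra. intros Ht.
    destruct (Hphi t) as [m [Hm _]]; [lra|].
    apply continuity_pt_filterlim, (ex_derive_continuous (K := R_AbsRing) (V := R_NormedModule)).
    now exists m.
  - rewrite Rmin_left, Rmax_right in Ht by lra.
    destruct (Hphi t Ht) as [m [Hm Km]]. rewrite (is_derive_unique _ _ _ Hm) in E.
    replace (Cmod (g z - g w)) with (phi 1 - phi 0); [lra|].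
    unfold phi, G.
    replace (w + 1 * (z - w))%C with z by ring. replace (w + 0 * (z - w))%C with w by ring.
    transitivity (fst (c * (g z - g w))%C); [simpl; ring|]. now rewrite Ec.
Qed.

(** * The Riemann sphere and the Lipschitz bound *)

Lemma Cnorm_Cmod (z : Cplx) : Cnorm z = Cmod z.
Proof. unfold Cnorm, Cmod; f_equal; ring. Qed.

Lemma Cdiff_at_Cder (g : Cplx -> Cplx) (z : Cplx) : Cdiff_at g z -> exists l, Cder g z l.
Proof.
  intros [l Hl]. exists l. intros eps He. destruct (Hl eps He) as [d [Hd H]].
  exists d; split; auto. intros w Hw.
  specialize (H w). rewrite !Cnorm_Cmod in H.
  destruct (Rle_lt_or_eq_dec 0 (Cmod (w - z)) (Cmod_ge_0 _)) as [Hp|Hz].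
  - apply H; split; auto.
  - symmetry in Hz. apply Cmod_eq_0 in Hz.
    assert (w = z) as -> by (replace w with ((w - z) + z)%C by ring; rewrite Hz; ring).
    replace (g z - g z - l * (z - z))%C with (RtoC 0) by ring.
    rewrite Cmod_0. pose proof (Cmod_ge_0 (z - z)). nra.
Qed.

(** Stereographic projection onto the unit sphere of R^3, with infinity at the north pole; [rhoS] is
    the chordal distance between images. *)
Definition stereo (u : option Cplx) : R * R * R :=
  match u with
  | Some z =>
      let q := fst z * fst z + snd z * snd z in
      (2 * fst z / (1 + q), 2 * snd z / (1 + q), (q - 1) / (1 + q))
  | None => (0, 0, 1)
  end.

(** The l1 distance avoids square roots and makes the triangle inequality coordinatewise; on the
    sphere it is comparable with [rhoS]. *)
Definition dist1 (p q : R * R * R) : R :=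
  Rabs (fst (fst p) - fst (fst q)) + Rabs (snd (fst p) - snd (fst q)) + Rabs (snd p - snd q).

Lemma dist1_sym (p q : R * R * R) : dist1 p q = dist1 q p.
Proof.
  unfold dist1. now rewrite (Rabs_minus_sym (fst (fst p))),
    (Rabs_minus_sym (snd (fst p))), (Rabs_minus_sym (snd p)).
Qed.

Lemma dist1_triangle (p q s : R * R * R) : dist1 p s <= dist1 p q + dist1 q s.
Proof.
  unfold dist1.
  assert (T : forall x y z, Rabs (x - z) <= Rabs (x - y) + Rabs (y - z)).
  { intros x y z. replace (x - z) with ((x - y) + (y - z)) by ring. apply Rabs_triang. }
  pose proof (T (fst (fst p)) (fst (fst q)) (fst (fst s))).
  pose proof (T (snd (fst p)) (snd (fst q)) (snd (fst s))).
  pose proof (T (snd p) (snd q) (snd s)). lra.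
Qed.

Lemma Cnorm_sq (z : Cplx) : Cnorm z * Cnorm z = fst z * fst z + snd z * snd z.
Proof. unfold Cnorm. apply sqrt_sqrt. nra. Qed.

Lemma rhoS_nonneg (u v : option Cplx) : 0 <= rhoS u v.
Proof.
  assert (S : forall z : Cplx, 0 < sqrt (1 + Cnorm z * Cnorm z)).
  { intros z. apply sqrt_lt_R0. nra. }
  destruct u as [z|], v as [w|]; simpl; try lra.
  - apply Rle_mult_inv_pos; [|apply Rmult_lt_0_compat; apply S].
    rewrite Cnorm_Cmod. pose proof (Cmod_ge_0 (Csub z w)); lra.
  - apply Rle_mult_inv_pos; [lra|apply S].
  - apply Rle_mult_inv_pos; [lra|apply S].
Qed.

Lemma rhoS_stereo (u v : option Cplx) :
  rhoS u v * rhoS u v =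
    (fst (fst (stereo u)) - fst (fst (stereo v))) ^ 2 +
    (snd (fst (stereo u)) - snd (fst (stereo v))) ^ 2 +
    (snd (stereo u) - snd (stereo v)) ^ 2.
Proof.
  assert (S : forall z : Cplx, sqrt (1 + Cnorm z * Cnorm z) * sqrt (1 + Cnorm z * Cnorm z)
     = 1 + (fst z * fst z + snd z * snd z)).
  { intros z. rewrite sqrt_sqrt by nra. now rewrite Cnorm_sq. }
  assert (Sp : forall z : Cplx, sqrt (1 + Cnorm z * Cnorm z) <> 0).
  { intros z. apply Rgt_not_eq, sqrt_lt_R0. nra. }
  destruct u as [[x y]|], v as [[x' y']|]; simpl rhoS; unfold stereo; cbn [fst snd].
  - set (s := sqrt (1 + Cnorm (x, y) * Cnorm (x, y))) in *.
    set (s' := sqrt (1 + Cnorm (x', y') * Cnorm (x', y'))) in *.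
    pose proof (S (x, y)) as E; pose proof (S (x', y')) as E'.
    pose proof (Sp (x, y)) as F; pose proof (Sp (x', y')) as F'. fold s in E, F; fold s' in E', F'.
    cbn [fst snd] in E, E'.
    set (n := Cnorm (Csub (x, y) (x', y'))).
    assert (En : n * n = (x - x') * (x - x') + (y - y') * (y - y'))
      by (unfold n; rewrite Cnorm_sq; reflexivity).
    replace (2 * n / (s * s') * (2 * n / (s * s'))) with (4 * (n * n) / ((s * s) * (s' * s')))
      by (field; auto).
    rewrite E, E', En. field. split; nra.
  - pose proof (S (x, y)) as E; pose proof (Sp (x, y)) as F.
    set (s := sqrt (1 + Cnorm (x, y) * Cnorm (x, y))) in *. cbn [fst snd] in E.
    replace (2 / s * (2 / s)) with (4 / (s * s)) by (field; auto). rewrite E. field. nra.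
  - pose proof (S (x', y')) as E; pose proof (Sp (x', y')) as F.
    set (s := sqrt (1 + Cnorm (x', y') * Cnorm (x', y'))) in *. cbn [fst snd] in E.
    replace (2 / s * (2 / s)) with (4 / (s * s)) by (field; auto). rewrite E. field. nra.
  - ring.
Qed.

Lemma rhoS_le_dist1 (u v : option Cplx) : rhoS u v <= dist1 (stereo u) (stereo v).
Proof.
  pose proof (rhoS_stereo u v) as E. pose proof (rhoS_nonneg u v). unfold dist1.
  rewrite <- !Rsqr_pow2, !(Rsqr_abs (_ - _)) in E. unfold Rsqr in E.
  pose proof (Rabs_pos (fst (fst (stereo u)) - fst (fst (stereo v)))).
  pose proof (Rabs_pos (snd (fst (stereo u)) - snd (fst (stereo v)))).
  pose proof (Rabs_pos (snd (stereo u) - snd (stereo v))). nra.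
Qed.

Lemma dist1_le_rhoS (u v : option Cplx) : dist1 (stereo u) (stereo v) <= 3 * rhoS u v.
Proof.
  pose proof (rhoS_stereo u v) as E. pose proof (rhoS_nonneg u v). unfold dist1.
  assert (A : forall t, t ^ 2 <= rhoS u v * rhoS u v -> Rabs t <= rhoS u v).
  { intros t Ht. apply Rabs_le. split; nra. }
  pose proof (pow2_ge_0 (fst (fst (stereo u)) - fst (fst (stereo v)))).
  pose proof (pow2_ge_0 (snd (fst (stereo u)) - snd (fst (stereo v)))).
  pose proof (pow2_ge_0 (snd (stereo u) - snd (stereo v))).
  pose proof (A (fst (fst (stereo u)) - fst (fst (stereo v))) ltac:(lra)).
  pose proof (A (snd (fst (stereo u)) - snd (fst (stereo v))) ltac:(lra)).
  pose proof (A (snd (stereo u) - snd (stereo v)) ltac:(lra)). lra.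
Qed.

(** The 6 is the factor 3 between [dist1] and [rhoS] times the 2 in the numerator of [rhoS], whose
    denominator is at least 1. *)
Lemma dist1_stereo_Lipschitz (z w : Cplx) :
  dist1 (stereo (Some z)) (stereo (Some w)) <= 6 * Cmod (z - w)%C.
Proof.
  eapply Rle_trans; [apply dist1_le_rhoS|]. simpl. rewrite Cnorm_Cmod.
  change (Csub z w) with (z - w)%C.
  assert (S : forall z : Cplx, 1 <= sqrt (1 + Cnorm z * Cnorm z)).
  { intros t. rewrite <- sqrt_1 at 1. apply sqrt_le_1_alt. nra. }
  pose proof (S z) as Sz; pose proof (S w) as Sw. pose proof (Cmod_ge_0 (z - w)) as P.
  set (c := sqrt (1 + Cnorm z * Cnorm z)) in *. set (d := sqrt (1 + Cnorm w * Cnorm w)) in *.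
  assert (1 <= c * d) by nra.
  assert (2 * Cmod (z - w) / (c * d) <= 2 * Cmod (z - w)); [|lra].
  apply Rle_div_l; [lra|]. nra.
Qed.

(* Inversion acts on the sphere as a rotation. *)
Lemma stereo_inv (u : option Cplx) (k : C) :
  match u with Some v => (v * k)%C = 1 | None => k = C0 end ->
  stereo u = (fst (fst (stereo (Some k))), - snd (fst (stereo (Some k))), - snd (stereo (Some k))).
Proof.
  destruct u as [[x y]|].
  - intros E. assert (Hv : (x, y) <> RtoC 0).
    { intros K. rewrite K in E. rewrite Cmult_0_l in E. apply RtoC_inj in E. lra. }
    assert (Hq : x * x + y * y <> 0).
    { intros K. apply Hv. unfold RtoC. f_equal; nra. }
    assert (Hq' : 1 + (x * x + y * y) <> 0) by nra.
    assert (Ek : k = (x / (x * x + y * y), - y / (x * x + y * y))).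
    { transitivity (/ ((x, y) : C))%C.
      - transitivity (/ ((x, y) : C) * (((x, y) : C) * k))%C; [field; auto|rewrite E; ring].
      - unfold Cinv; simpl. f_equal; field; auto. }
    subst k. unfold stereo; cbn [fst snd].
    set (q := x * x + y * y) in *.
    assert (Eq : x / q * (x / q) + - y / q * (- y / q) = / q).
    { transitivity (q / (q * q)); [unfold q; field; auto|field; auto]. }
    rewrite Eq.
    assert (1 + / q <> 0).
    { intros K. apply Hq'. replace (1 + q) with (q * (1 + / q)) by (field; auto). rewrite K; ring. }
    f_equal; [f_equal|]; field; repeat split; auto; lra.
  - intros ->. unfold stereo, C0; simpl. f_equal; [f_equal|]; field.
Qed.

(** This allows passing from f to 1/f: inversion flips the signs of two coordinates, which the l1
    distance does not see. *)
Lemma dist1_stereo_inv (u u' : option Cplx) (k k' : C) :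
  match u with Some v => (v * k)%C = 1 | None => k = C0 end ->
  match u' with Some v => (v * k')%C = 1 | None => k' = C0 end ->
  dist1 (stereo u) (stereo u') = dist1 (stereo (Some k)) (stereo (Some k')).
Proof.
  intros H H'. rewrite (stereo_inv u k H), (stereo_inv u' k' H'). unfold dist1; cbn [fst snd].
  f_equal; [f_equal|]; rewrite <- Rabs_Ropp; f_equal; ring.
Qed.

(** * Zeros, poles and circles that stay away from them *)

Lemma set_card_witness (P : nat -> Prop) (m : nat) : (0 < m)%nat -> set_card P m -> exists n, P n.
Proof.
  intros Hm (l & _ & Hl & HP). destruct l as [|n l]; simpl in Hl; [lia|].
  exists n. apply HP. now left.
Qed.

Section Divisor.

Variables (f : Cplx -> option Cplx) (Ia Ib : nat -> Prop) (a b : nat -> Cplx).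
Hypothesis Hdiv : is_divisor f Ia a Ib b.

Lemma pole_index (z : Cplx) : f z = None -> exists n, Ib n /\ b n = z.
Proof.
  intros Hz. destruct (Hdiv z) as (m1 & m2 & _ & _ & [[_ Hn]|[Hm _]] & Hc); [contradiction|].
  now apply set_card_witness with m2.
Qed.

Lemma zero_index (z : Cplx) : f z = Some C0 -> exists n, Ia n /\ a n = z.
Proof.
  intros Hz. destruct (Hdiv z) as (m1 & m2 & [[_ Hn]|[Hm _]] & Hc & _); [contradiction|].
  now apply set_card_witness with m1.
Qed.

End Divisor.

(* Pigeonhole: N concentric circles around z, equally spaced by 2 delta; if each
   comes within delta of a zero or a pole, these N zeros and poles are distinct. *)
Lemma circle_avoiding_divisor (Ia Ib : nat -> Prop) (a b : nat -> Cplx) (Cc rho : R) :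
  0 < rho <= 1 ->
  (forall c : Cplx, forall la lb : list nat, NoDup la -> NoDup lb ->
     (forall n, In n la -> Ia n /\ Cnorm (Csub (a n) c) <= 1) ->
     (forall n, In n lb -> Ib n /\ Cnorm (Csub (b n) c) <= 1) ->
     INR (length la + length lb) < Cc) ->
  exists delta, 0 < delta /\ forall z : C, exists r, rho / 2 <= r <= rho /\
    forall w : C, Cmod (w - z) = r -> ~ inA Ia a Ib b delta w.
Proof.
  intros Hrho Hcard.
  destruct (INR_unbounded (Rmax Cc 1)) as [N HN].
  pose proof (Rmax_l Cc 1); pose proof (Rmax_r Cc 1).
  assert (Np : 0 < INR N) by lra.
  (* [N] steps of length [2 * delta] lead from radius [rho / 2] exactly to [rho]. *)
  set (delta := rho / (4 * INR N)).
  assert (Hdelta : 0 < delta) by (apply Rdiv_lt_0_compat; lra).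
  assert (EN : 2 * delta * INR N = rho / 2) by (unfold delta; field; lra).
  exists delta; split; auto. intros z.
  set (rad := fun j : nat => rho / 2 + 2 * delta * INR j).
  pose (good := fun r => forall w : C, Cmod (w - z) = r -> ~ inA Ia a Ib b delta w).
  (* The strict bound [rad k - delta] is the inner edge of the annulus around the next circle, so an
     index found there cannot already be in the lists. *)
  assert (Hind : forall k, (exists j, (j < k)%nat /\ good (rad j)) \/
    exists la lb, NoDup la /\ NoDup lb /\ (length la + length lb = k)%nat /\
      (forall n, In n la -> Ia n /\ Cmod (a n - z)%C < rad k - delta) /\
      (forall n, In n lb -> Ib n /\ Cmod (b n - z)%C < rad k - delta)).
  { induction k as [|k IH].
    - right. exists nil, nil. repeat split; try constructor; simpl; tauto.
    - destruct IH as [[j [Hj Hg]]|(la & lb & Na & Nb & Hlen & Ha & Hb)].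
      { left; exists j; split; [lia|auto]. }
      destruct (classic (good (rad k))) as [Hg|Hg]; [left; exists k; auto|].
      right. apply not_all_ex_not in Hg. destruct Hg as [w Hw].
      apply imply_to_and in Hw. destruct Hw as [Hwr Hin]. apply NNPP in Hin.
      assert (Hrad : rad (S k) = rad k + 2 * delta) by (unfold rad; rewrite S_INR; ring).
      assert (Hnear : forall p : C, Cmod (w - p) < delta ->
                rad k - delta < Cmod (p - z) < rad (S k) - delta).
      { intros p Hp.
        pose proof (Cmod_triangle (w - p) (p - z)) as T1.
        replace (w - p + (p - z))%C with (w - z)%C in T1 by ring.
        pose proof (Cmod_triangle (- (w - p)) (w - z)) as T2.
        replace (- (w - p) + (w - z))%C with (p - z)%C in T2 by ring.
        rewrite Cmod_opp in T2. lra. }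
      destruct Hin as [[n [Hn Hd]]|[n [Hn Hd]]]; rewrite Cnorm_Cmod in Hd;
        destruct (Hnear _ Hd) as [N1 N2].
      + exists (n :: la), lb. repeat split; auto.
        * constructor; auto. intros Hi. destruct (Ha n Hi). lra.
        * simpl; lia.
        * destruct H1 as [->|Hi]; auto. now apply Ha.
        * destruct H1 as [->|Hi]; auto. destruct (Ha n0 Hi); lra.
        * now apply Hb.
        * destruct (Hb n0 H1); lra.
      + exists la, (n :: lb). repeat split; auto.
        * constructor; auto. intros Hi. destruct (Hb n Hi). lra.
        * simpl; lia.
        * now apply Ha.
        * destruct (Ha n0 H1); lra.
        * destruct H1 as [->|Hi]; auto. now apply Hb.
        * destruct H1 as [->|Hi]; auto. destruct (Hb n0 Hi); lra. }
  destruct (Hind N) as [[j [Hj Hg]]|(la & lb & Na & Nb & Hlen & Ha & Hb)].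
  - exists (rad j). split; [|exact Hg]. apply lt_INR in Hj. pose proof (pos_INR j).
    unfold rad. nra.
  (* The [N] indices found lie within [rho <= 1] of [z], while [N] was chosen above the permitted
     number [Cc]. *)
  - exfalso. assert (Hr : rad N = rho) by (unfold rad; rewrite EN; field).
    specialize (Hcard z la lb Na Nb). rewrite Hlen in Hcard.
    enough (INR N < Cc) by lra. apply Hcard.
    + intros n Hn. destruct (Ha n Hn). split; auto. rewrite Cnorm_Cmod.
      change (Csub (a n) z) with (a n - z)%C. lra.
    + intros n Hn. destruct (Hb n Hn). split; auto. rewrite Cnorm_Cmod.
      change (Csub (b n) z) with (b n - z)%C. lra.
Qed.

(** * Local Lipschitz bounds for f and 1/f *)

Lemma Lipschitz_of_circle_bounds (g : C -> C) (z0 : C) (rho M : R) :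
  0 < rho -> 0 <= M ->
  (forall z : C, Cmod (z - z0) < 2 * rho -> exists l, Cder g z l) ->
  (forall z : C, Cmod (z - z0) < rho -> exists r, rho / 2 <= r <= rho /\
     forall w : C, Cmod (w - z) = r -> Cmod (g w) <= M) ->
  forall z w : C, Cmod (z - z0) < rho -> Cmod (w - z0) < rho ->
  Cmod (g z - g w) <= 2 * M / rho * Cmod (z - w).
Proof.
  intros Hrho HM Hg Hc. apply Lipschitz_of_bounded_derivative. intros z Hz.
  destruct (Hg z) as [l Hl]; [lra|]. exists l; split; auto.
  destruct (Hc z Hz) as [r [Hr Hb]].
  apply Rle_trans with (M / r).
  - apply (Cauchy_estimate g z l r (2 * rho - Cmod (z - z0))); auto; [lra|].
    intros w Hw. apply Hg. replace (w - z0)%C with ((w - z) + (z - z0))%C by ring.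
    eapply Rle_lt_trans; [apply Cmod_triangle|]. lra.
  - apply Rle_div_l; [lra|].
    replace (2 * M / rho * r) with (M * (2 * r / rho)) by (field; lra).
    rewrite <- (Rmult_1_r M) at 1. apply Rmult_le_compat_l; auto.
    apply Rle_div_r; lra.
Qed.

Lemma Cinv_unique (x y : C) : (x * y)%C = 1 -> x = (/ y)%C.
Proof.
  intros E. assert (Hy : y <> 0).
  { intros K. rewrite K, Cmult_0_r in E. apply RtoC_inj in E. lra. }
  transitivity (x * y * / y)%C; [field; auto|rewrite E; ring].
Qed.

Lemma meromorphic_finite_Cder (f : Cplx -> option Cplx) (z : Cplx) (v : Cplx) :
  meromorphic f -> f z = Some v ->
  exists r g l, 0 < r /\ Cder g z l /\ forall w : C, Cmod (w - z) < r -> f w = Some (g w).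
Proof.
  intros Hm Hz. destruct (Hm z) as (r & Hr & [(g & Hg & E)|[Hn _]]); [|congruence].
  destruct (Cdiff_at_Cder g z) as [l Hl].
  { apply Hg. rewrite Cnorm_Cmod. change (Csub z z) with (z - z)%C.
    replace (z - z)%C with (RtoC 0) by ring. now rewrite Cmod_0. }
  exists r, g, l. repeat split; auto. intros w Hw. apply E. now rewrite Cnorm_Cmod.
Qed.

Definition finite_part (u : option Cplx) : C := match u with Some v => v | None => C0 end.

(** The value [C0] at infinity is the true value of 1/f at a pole; the inverse of 0 is meaningless,
    so this chart serves only away from zeros. *)
Definition reciprocal (u : option Cplx) : C := match u with Some v => (/ v)%C | None => C0 end.

Lemma finite_part_Cder (f : Cplx -> option Cplx) (z : Cplx) :
  meromorphic f -> f z <> None -> exists l, Cder (fun w => finite_part (f w)) z l.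
Proof.
  intros Hm Hz. destruct (f z) as [v|] eqn:E; [|congruence].
  destruct (meromorphic_finite_Cder f z v Hm E) as (r & g & l & Hr & Hl & Eg).
  exists l. apply Cder_ext_loc with (f := g) (r := r); auto.
  intros w Hw. now rewrite Eg.
Qed.

(** At a finite nonzero value the chain rule applies; at a pole 1/f coincides near [z] with the
    function [h] supplied by [meromorphic]. *)
Lemma reciprocal_Cder (f : Cplx -> option Cplx) (z : Cplx) :
  meromorphic f -> f z <> Some C0 -> exists l, Cder (fun w => reciprocal (f w)) z l.
Proof.
  intros Hm Hz. destruct (f z) as [v|] eqn:E.
  - destruct (meromorphic_finite_Cder f z v Hm E) as (r & g & l & Hr & Hl & Eg).
    assert (Hgz : g z = v).
    { rewrite Eg in E; [now injection E|].
      replace (z - z)%C with (RtoC 0) by ring. now rewrite Cmod_0. }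
    eexists. apply Cder_ext_loc with (f := fun w => (/ g w)%C) (r := r); auto.
    + intros w Hw. now rewrite Eg.
    + apply (Cder_comp Cinv g); [exact Hl|]. apply Cder_inv. rewrite Hgz. intros K. apply Hz. f_equal. exact K.
  - destruct (Hm z) as (r & Hr & [(g & Hg & Eg)|(_ & h & Hh & Hhz & Eh)]).
    { rewrite Eg in E; [discriminate|]. rewrite Cnorm_Cmod. change (Csub z z) with (z - z)%C.
      replace (z - z)%C with (RtoC 0) by ring. now rewrite Cmod_0. }
    destruct (Cdiff_at_Cder h z) as [l Hl].
    { apply Hh. rewrite Cnorm_Cmod. change (Csub z z) with (z - z)%C.
      replace (z - z)%C with (RtoC 0) by ring. now rewrite Cmod_0. }
    exists l. apply Cder_ext_loc with (f := h) (r := r); auto.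
    intros w Hw. destruct (Rle_lt_or_eq_dec 0 (Cmod (w - z)) (Cmod_ge_0 _)) as [Hp|Hq].
    + destruct (Eh w) as (Hn & v & Ev & Hv); [now rewrite Cnorm_Cmod|].
      rewrite Ev. unfold reciprocal.
      change ((h w * v)%C = 1) in Hv.
      now apply Cinv_unique.
    + symmetry in Hq. apply Cmod_eq_0 in Hq.
      assert (w = z) as -> by (replace w with ((w - z) + z)%C by ring; rewrite Hq; ring).
      now rewrite E.
Qed.

Theorem stereo_uniformly_Lipschitz
  (f : Cplx -> option Cplx) (Ia : nat -> Prop) (a : nat -> Cplx) (Ib : nat -> Prop) (b : nat -> Cplx) :
  meromorphic f ->
  is_divisor f Ia a Ib b ->
  (forall delta, 0 < delta -> exists Cd, 0 < Cd /\
     forall z, ~ inA Ia a Ib b delta z ->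
       exists v, f z = Some v /\ / Cd <= Cnorm v <= Cd) ->
  (exists eta, 0 < eta /\ forall n k, Ia n -> Ib k -> eta <= Cnorm (Csub (a n) (b k))) ->
  (exists C0, forall c : Cplx, forall la lb : list nat,
     NoDup la -> NoDup lb ->
     (forall n, In n la -> Ia n /\ Cnorm (Csub (a n) c) <= 1) ->
     (forall n, In n lb -> Ib n /\ Cnorm (Csub (b n) c) <= 1) ->
     INR (length la + length lb) < C0) ->
  exists K rho, 0 < K /\ 0 < rho /\ forall z w : C, Cmod (w - z) < rho ->
    dist1 (stereo (f z)) (stereo (f w)) <= K * Cmod (w - z).
Proof.
  intros Hm Hdiv Hbd (eta & Heta & Hsep) (Cc & Hcard).
  (* A zero and a pole both within [2 * rho] of a point would be less than [4 * rho <= eta] apart;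
     [rho <= 1] fits the counting in unit discs. *)
  set (rho := Rmin 1 (eta / 4)).
  assert (Hrho : 0 < rho) by (apply Rmin_pos; lra).
  assert (Hrho1 : rho <= 1) by apply Rmin_l.
  assert (Hrho2 : rho <= eta / 4) by apply Rmin_r.
  destruct (circle_avoiding_divisor Ia Ib a b Cc rho) as [delta [Hdelta Hcirc]]; auto.
  destruct (Hbd delta Hdelta) as (M & HM & Hf).
  exists (6 * (2 * M / rho)), rho. repeat split; auto.
  { apply Rmult_lt_0_compat; [lra|]. apply Rdiv_lt_0_compat; lra. }
  intros z w Hw.
  assert (Hzz : Cmod (z - z) < rho)
    by (replace (z - z)%C with (RtoC 0) by ring; now rewrite Cmod_0).
  rewrite dist1_sym, Rmult_assoc.
  (* Circles of radius up to [rho] about points within [rho] of [z] reach out to [2 * rho], so the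
     choice between 1/f and f is made on that disc. *)
  destruct (classic (exists n, Ib n /\ Cmod (b n - z)%C < 2 * rho)) as [[n [In Hn]]|Hno].
  - assert (Hnz : forall t : C, Cmod (t - z) < 2 * rho -> f t <> Some C0).
    { intros t Ht E. destruct (zero_index f Ia Ib a b Hdiv t E) as [m [Im <-]].
      pose proof (Hsep m n Im In) as Hs. rewrite Cnorm_Cmod in Hs.
      pose proof (Cmod_triangle (a m - z) (- (b n - z))) as T. rewrite Cmod_opp in T.
      change (Csub (a m) (b n)) with (a m - b n)%C in Hs.
      replace (a m - z + - (b n - z))%C with (a m - b n)%C in T by ring.
      lra. }
    assert (Hinv : forall t : C, Cmod (t - z) < 2 * rho ->
      match f t with Some v => (v * reciprocal (f t))%C = 1 | None => reciprocal (f t) = C0 end).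
    { intros t Ht. specialize (Hnz t Ht). destruct (f t) as [v|]; simpl; auto.
      apply Cinv_r. intros K. apply Hnz. f_equal. exact K. }
    rewrite (dist1_stereo_inv _ _ _ _ (Hinv w ltac:(lra)) (Hinv z ltac:(lra))).
    eapply Rle_trans; [apply dist1_stereo_Lipschitz|]. apply Rmult_le_compat_l; [lra|].
    apply (Lipschitz_of_circle_bounds (fun t => reciprocal (f t)) z); auto; [lra| |].
    + intros t Ht. apply reciprocal_Cder; auto.
    + intros t _. destruct (Hcirc t) as [r [Hr Hg]]. exists r; split; auto.
      intros s Hs. destruct (Hf s (Hg s Hs)) as (v & -> & Hv1 & Hv2). simpl.
      rewrite Cnorm_Cmod in Hv1.
      assert (0 < / M) by now apply Rinv_0_lt_compat.
      assert (v <> RtoC 0) by (apply Cmod_gt_0; lra).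
      rewrite Cmod_inv by auto. rewrite <- (Rinv_inv M). now apply Rinv_le_contravar.
  - assert (Hnp : forall t : C, Cmod (t - z) < 2 * rho -> f t <> None).
    { intros t Ht E. destruct (pole_index f Ia Ib a b Hdiv t E) as [m [Im <-]].
      apply Hno. now exists m. }
    assert (Hfin : forall t : C, Cmod (t - z) < 2 * rho -> f t = Some (finite_part (f t))).
    { intros t Ht. specialize (Hnp t Ht). destruct (f t); [reflexivity|congruence]. }
    rewrite (Hfin w ltac:(lra)), (Hfin z ltac:(lra)).
    eapply Rle_trans; [apply dist1_stereo_Lipschitz|]. apply Rmult_le_compat_l; [lra|].
    apply (Lipschitz_of_circle_bounds (fun t => finite_part (f t)) z); auto; [lra| |].
    + intros t Ht. apply finite_part_Cder; auto.
    + intros t _. destruct (Hcirc t) as [r [Hr Hg]]. exists r; split; auto.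
      intros s Hs. destruct (Hf s (Hg s Hs)) as (v & -> & Hv1 & Hv2). simpl.
      now rewrite Cnorm_Cmod in Hv2.
Qed.

(** * Compactness *)

Definition in_cube (p : R * R * R) : Prop :=
  Rabs (fst (fst p)) <= 1 /\ Rabs (snd (fst p)) <= 1 /\ Rabs (snd p) <= 1.

Lemma stereo_in_cube (u : option Cplx) : in_cube (stereo u).
Proof.
  destruct u as [[x y]|]; unfold in_cube, stereo; cbn [fst snd].
  - pose proof (pow2_ge_0 x). pose proof (pow2_ge_0 y).
    pose proof (pow2_ge_0 (1 + x)). pose proof (pow2_ge_0 (1 - x)).
    pose proof (pow2_ge_0 (1 + y)). pose proof (pow2_ge_0 (1 - y)).
    repeat split; apply Rabs_le; split;
      first [apply Rle_div_l; [lra|lra] | apply Rle_div_r; [lra|lra]].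
  - rewrite Rabs_R0, Rabs_R1. lra.
Qed.

(** Subsequences are carried as unbounded index sets, so that refining is mere inclusion; an
    increasing enumeration is extracted only once, at the end. *)
Definition infinite (S : nat -> Prop) : Prop := forall N, exists n, (N <= n)%nat /\ S n.

(** Bisection of [-1, 1] down to length [eps]. No limit is constructed, since only a Cauchy property
    is wanted. *)
Lemma infinite_refine_real (S : nat -> Prop) (x : nat -> R) (eps : R) :
  infinite S -> (forall n, Rabs (x n) <= 1) -> 0 < eps ->
  exists S', infinite S' /\ (forall n, S' n -> S n) /\
    forall n m, S' n -> S' m -> Rabs (x n - x m) <= eps.
Proof.
  intros HS Hx Heps.
  assert (Hk : forall k, exists S' c, infinite S' /\ (forall n, S' n -> S n) /\
    forall n, S' n -> c <= x n <= c + 2 * (/ 2) ^ k).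
  { induction k as [|k (S' & c & Hi & Hsub & Hc)].
    - exists S, (-1). repeat split; auto; specialize (Hx n); apply Rabs_le_between in Hx; simpl; lra.
    - set (h := (/ 2) ^ k) in *.
      destruct (classic (infinite (fun n => S' n /\ x n <= c + h))) as [Hl|Hl].
      + exists (fun n => S' n /\ x n <= c + h), c. repeat split; auto.
        * intros n [Hn _]; auto.
        * destruct H as [Hn _]. apply Hc in Hn; lra.
        * destruct H as [_ Hn]. simpl; fold h; lra.
      + exists (fun n => S' n /\ c + h <= x n), (c + h). repeat split.
        (* If the lower half is not visited infinitely often, all indices of [S'] from [N] on lie in
           the upper half. *)
        * apply not_all_ex_not in Hl. destruct Hl as [N HN]. intros M.
          destruct (Hi (Nat.max N M)) as [n [Hn HSn]]. exists n. split; [lia|]. split; auto.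
          apply Rnot_lt_le; intros Hlt. apply HN. exists n. repeat split; auto; [lia|lra].
        * intros n [Hn _]; auto.
        * now destruct H.
        * destruct H as [Hn _]. apply Hc in Hn. simpl; fold h; lra. }
  destruct (pow_lt_1_zero (/ 2)) with (y := eps / 2) as [N HN];
    [rewrite Rabs_pos_eq; lra|lra|].
  specialize (HN N (Nat.le_refl N)). rewrite Rabs_pos_eq in HN by (apply pow_le; lra).
  destruct (Hk N) as (S' & c & Hi & Hsub & Hc). exists S'. repeat split; auto.
  intros n m Hn Hm. apply Hc in Hn; apply Hc in Hm. apply Rabs_le; lra.
Qed.

Lemma infinite_refine_point (S : nat -> Prop) (u : nat -> R * R * R) (eps : R) :
  infinite S -> (forall n, in_cube (u n)) -> 0 < eps ->
  exists S', infinite S' /\ (forall n, S' n -> S n) /\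
    forall n m, S' n -> S' m -> dist1 (u n) (u m) <= eps.
Proof.
  intros HS Hu He.
  destruct (infinite_refine_real S (fun n => fst (fst (u n))) (eps / 3))
    as (S1 & I1 & Sub1 & H1); [auto|intros n; apply Hu|lra|].
  destruct (infinite_refine_real S1 (fun n => snd (fst (u n))) (eps / 3))
    as (S2 & I2 & Sub2 & H2); [auto|intros n; apply Hu|lra|].
  destruct (infinite_refine_real S2 (fun n => snd (u n)) (eps / 3))
    as (S3 & I3 & Sub3 & H3); [auto|intros n; apply Hu|lra|].
  exists S3. repeat split; auto. intros n m Hn Hm. unfold dist1.
  specialize (H3 n m Hn Hm). specialize (H2 n m (Sub3 n Hn) (Sub3 m Hm)).
  specialize (H1 n m (Sub2 n (Sub3 n Hn)) (Sub2 m (Sub3 m Hm))). lra.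
Qed.

Lemma infinite_refine_list (S : nat -> Prop) (G : nat -> C -> R * R * R) (l : list C) (eps : R) :
  infinite S -> (forall n z, in_cube (G n z)) -> 0 < eps ->
  exists S', infinite S' /\ (forall n, S' n -> S n) /\
    forall p, In p l -> forall n m, S' n -> S' m -> dist1 (G n p) (G m p) <= eps.
Proof.
  intros HS HG He. induction l as [|p l (S1 & I1 & Sub1 & H1)].
  - exists S. repeat split; auto. simpl; tauto.
  - destruct (infinite_refine_point S1 (fun n => G n p) eps) as (S2 & I2 & Sub2 & H2); auto.
    exists S2. repeat split; auto. intros q [<-|Hq] n m Hn Hm; auto.
Qed.

Lemma disc_finite_net (J d : R) : 0 < d ->
  exists l : list C, forall z : C, Cmod z <= J -> exists p, In p l /\ Cmod (z - p) < d.
Proof.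
  (* Each coordinate is approximated within [h], so the distance to the grid is at most
     [2 * h < d]. *)
  intros Hd. set (h := d / 3). assert (Hh : 0 < h) by (unfold h; lra).
  destruct (INR_unbounded (2 * J / h)) as [N HN].
  exists (map (fun ij => (- J + INR (fst ij) * h, - J + INR (snd ij) * h) : C)
              (list_prod (seq 0 N) (seq 0 N))).
  assert (Hx : forall x, Rabs x <= J -> exists i, In i (seq 0 N) /\ Rabs (x - (- J + INR i * h)) <= h).
  { intros x Hx. apply Rabs_le_between in Hx.
    destruct (nfloor_ex ((x + J) / h)) as [i [Hi1 Hi2]].
    { apply Rle_mult_inv_pos; lra. }
    exists i. split.
    - apply in_seq. split; [lia|]. apply INR_lt. simpl.
      assert ((x + J) / h <= 2 * J / h); [|lra].
      apply Rmult_le_compat_r; [left; now apply Rinv_0_lt_compat|lra].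
    - assert (E : (x + J) / h * h = x + J) by (field; lra).
      apply Rabs_le. split; nra. }
  intros z Hz. pose proof (Re_Cmod z); pose proof (Im_Cmod z).
  destruct (Hx (fst z)) as [i [Hi Ei]]; [lra|]. destruct (Hx (snd z)) as [j [Hj Ej]]; [lra|].
  exists (- J + INR i * h, - J + INR j * h). split.
  - apply in_map_iff. exists (i, j). split; auto. now apply in_prod.
  - eapply Rle_lt_trans; [apply Cmod_Re_Im|]. simpl. unfold Rminus in Ei, Ej. unfold h in *; lra.
Qed.

(** Diagonal argument: stage [j] thins the index set until the functions differ by less than
    [/ (INR j + 1)] on the disc of radius [j]. A finite net suffices at each stage by
    equicontinuity. *)
Theorem Arzela_Ascoli_cube (G : nat -> C -> R * R * R) :
  (forall n z, in_cube (G n z)) ->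
  (forall eps, 0 < eps -> exists d, 0 < d /\ forall n (z w : C), Cmod (w - z) < d ->
     dist1 (G n z) (G n w) < eps) ->
  exists phi : nat -> nat, (forall n, (phi n < phi (S n))%nat) /\
    forall Rad eps, 0 < eps -> exists N, forall n m, (N <= n)%nat -> (N <= m)%nat ->
      forall z : C, Cmod z <= Rad -> dist1 (G (phi n) z) (G (phi m) z) < eps.
Proof.
  intros HG Heq.
  assert (Hstep : forall (j : nat) (T : {T | infinite T}), exists T' : {T | infinite T},
    (forall n, proj1_sig T' n -> proj1_sig T n) /\
    forall n m, proj1_sig T' n -> proj1_sig T' m -> forall z : C, Cmod z <= INR j ->
      dist1 (G n z) (G m z) < / (INR j + 1)).
  { intros j [T HT]. pose proof (pos_INR j).
    set (e := / (INR j + 1)). assert (He : 0 < e) by (apply Rinv_0_lt_compat; lra).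
    destruct (Heq (e / 4)) as [d [Hd HE]]; [lra|].
    destruct (disc_finite_net (INR j) d Hd) as [l Hl].
    destruct (infinite_refine_list T G l (e / 4)) as (T' & I' & Sub & HT'); auto; [lra|].
    exists (exist _ T' I'). simpl. split; auto. intros n m Hn Hm z Hz.
    destruct (Hl z Hz) as [p [Hp Hzp]].
    pose proof (HE n p z Hzp) as A1. rewrite dist1_sym in A1.
    pose proof (HE m p z Hzp) as A2.
    pose proof (HT' p Hp n m Hn Hm) as A3.
    pose proof (dist1_triangle (G n z) (G n p) (G m z)).
    pose proof (dist1_triangle (G n p) (G m p) (G m z)). lra. }
  assert (Hall : infinite (fun _ => True)) by (intros N; exists N; auto).
  pose (T := fix T j := match j with
     | O => exist infinite _ Hall
     | S k => proj1_sig (constructive_indefinite_description _ (Hstep k (T k))) end).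
  assert (HTS : forall j, (forall n, proj1_sig (T (S j)) n -> proj1_sig (T j) n) /\
    forall n m, proj1_sig (T (S j)) n -> proj1_sig (T (S j)) m -> forall z : C, Cmod z <= INR j ->
      dist1 (G n z) (G m z) < / (INR j + 1)).
  { intros j. exact (proj2_sig (constructive_indefinite_description _ (Hstep j (T j)))). }
  assert (Hpick : forall j N, exists n, (N < n)%nat /\ proj1_sig (T j) n).
  { intros j N. destruct (proj2_sig (T j) (S N)) as [n [Hn Hj]]. exists n; split; auto. }
  pose (phi := fix phi j := match j with
     | O => proj1_sig (constructive_indefinite_description _ (Hpick O O))
     | S k => proj1_sig (constructive_indefinite_description _ (Hpick (S k) (phi k))) end).
  assert (Hphi : forall j, proj1_sig (T j) (phi j)).
  { intros [|j]; [exact (proj2 (proj2_sig (constructive_indefinite_description _ (Hpick O O))))|].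
    exact (proj2 (proj2_sig (constructive_indefinite_description _ (Hpick (S j) (phi j))))). }
  exists phi. split.
  { intros j. exact (proj1 (proj2_sig (constructive_indefinite_description _ (Hpick (S j) (phi j))))). }
  assert (Hmono : forall j k n, proj1_sig (T (j + k)%nat) n -> proj1_sig (T j) n).
  { intros j k n. induction k as [|k IH]; [now rewrite Nat.add_0_r|].
    rewrite Nat.add_succ_r. intros H. apply IH. now apply HTS. }
  intros Rad eps He.
  destruct (INR_unbounded (Rmax Rad (/ eps))) as [j Hj].
  pose proof (Rmax_l Rad (/ eps)); pose proof (Rmax_r Rad (/ eps)).
  (* The estimate of stage [j] holds on [T (S j)], which contains [phi k] for every [k] from [S j]
     on. *)
  exists (S j). intros n m Hn Hm z Hz.
  assert (Hin : forall k, (S j <= k)%nat -> proj1_sig (T (S j)) (phi k)).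
  { intros k Hk. apply Hmono with (k - S j)%nat.
    replace (S j + (k - S j))%nat with k by lia. apply Hphi. }
  apply Rlt_le_trans with (/ (INR j + 1)).
  - apply HTS; auto; lra.
  - rewrite <- (Rinv_inv eps). apply Rinv_le_contravar; [now apply Rinv_0_lt_compat|lra].
Qed.

Theorem mainTheorem12
  (f : Cplx -> option Cplx) (Ia : nat -> Prop) (a : nat -> Cplx) (Ib : nat -> Prop) (b : nat -> Cplx) :
  meromorphic f ->
  is_divisor f Ia a Ib b ->
  (forall delta, 0 < delta -> exists Cd, 0 < Cd /\
     forall z, ~ inA Ia a Ib b delta z ->
       exists v, f z = Some v /\ / Cd <= Cnorm v <= Cd) ->
  (exists eta, 0 < eta /\ forall n k, Ia n -> Ib k -> eta <= Cnorm (Csub (a n) (b k))) ->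
  (exists C0, forall c : Cplx, forall la lb : list nat,
     NoDup la -> NoDup lb ->
     (forall n, In n la -> Ia n /\ Cnorm (Csub (a n) c) <= 1) ->
     (forall n, In n lb -> Ib n /\ Cnorm (Csub (b n) c) <= 1) ->
     INR (length la + length lb) < C0) ->
  normal_function f.
Proof.
  intros Hm Hdiv Hbd Hsep Hcard h.
  destruct (stereo_uniformly_Lipschitz f Ia a Ib b Hm Hdiv Hbd Hsep Hcard)
    as (K & rho & HK & Hrho & HL).
  destruct (Arzela_Ascoli_cube (fun n z => stereo (f (Cadd z (h n))))) as [phi [Hphi HC]].
  - intros n z. apply stereo_in_cube.
  (* Translation preserves differences, so one [K] and one [rho] give equicontinuity for all [h n]
     at once. *)
  - intros eps He. exists (Rmin rho (eps / K)). split.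
    { apply Rmin_pos; auto. now apply Rdiv_lt_0_compat. }
    intros n z w Hw. pose proof (Rmin_l rho (eps / K)); pose proof (Rmin_r rho (eps / K)).
    assert (E : Cmod (Cplus w (h n) - Cplus z (h n))%C = Cmod (w - z)) by (f_equal; ring).
    eapply Rle_lt_trans; [apply HL|].
    + change (Cadd w (h n)) with (Cplus w (h n)). change (Cadd z (h n)) with (Cplus z (h n)).
      rewrite E. lra.
    + change (Cadd w (h n)) with (Cplus w (h n)). change (Cadd z (h n)) with (Cplus z (h n)).
      rewrite E. rewrite Rmult_comm. apply Rlt_div_r; lra.
  - exists phi. split; auto. intros Rad eps He. destruct (HC Rad eps He) as [N HN].
    exists N. intros n m Hn Hm' z Hz. eapply Rle_lt_trans; [apply rhoS_le_dist1|].
    apply HN; auto. now rewrite <- Cnorm_Cmod.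
Qed.
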